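(* Let $P$ be a simple polyhedron with facet set indexed by $\mathcal{S}$, let $V=\{v_i\mid i\in\mathcal{S}\}$ be a set of normal vectors to the facets of $P$, and let $\mathcal{B}$ be a $P$-building set. Then the fan $\mathcal{F}(P,V,\mathcal{B})$ is the normal fan of a $P$-nestohedron of $\mathcal{B}$, obtained by listing all sets $I_1,\dots,I_k$ of $\mathcal{B}$ in descending order of size and truncating, in this order, the faces $F_I$ of $P$ with hyperplanes normal to the vectors $v_I=\sum_{i\in I}v_i$.
   Context: A full-dimensional polyhedron in $\mathbb{R}^n$ is simple if every nonempty codimension-$k$ face is contained in exactly $k$ facets. Let $P$ be such a polyhedron with facets $\{F_s\mid s\in\mathcal{S}\}$, $F_I=\bigcap_{s\in I}F_s$ for $I\subseteq\mathcal{S}$, and $\Delta(P)=\{I\subseteq\mathcal{S}\mid F_I\neq\emptyset\}$ its dual simplicial complex. For a nonempty face $F$ of a polyhedron $Q$, the normal cone of $F$ is the set of vectors $v$ such that $x\mapsto x\cdot v$ attains its maximum over $Q$ at every point of $F$; the normal fan of $Q$ is the collection of normal cones of nonempty faces. A normal vector of a facet is a nonzero vector spanning its normal cone (an outer normal). A $P$-building set is a set $\mathcal{B}$ of nonempty faces of $\Delta=\Delta(P)$ containing all singletons $\{s\}$, such that whenever $S_1,S_2\in\mathcal{B}$, $S_1\cap S_2\neq\emptyset$ and $S_1\cup S_2\in\Delta$, then $S_1\cup S_2\in\mathcal{B}$. A subset $N\subseteq\mathcal{B}$ is nested if for any pairwise incomparable $x_1,\dots,x_t\in N$, $t\ge2$,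 the union $x_1\cup\cdots\cup x_t$ is in $\Delta$ and not in $\mathcal{B}$. A $P$-nestohedron of $\mathcal{B}$ is a simple polyhedron whose dual simplicial complex is isomorphic to the complex of nested subsets of $\mathcal{B}$. For nested $N$, let $K^V_N$ be the set of nonnegative linear combinations of the vectors $\sum_{i\in I}v_i$, $I\in N$; $\mathcal{F}(P,V,\mathcal{B})$ is the collection of all cones $K^V_N$, $N$ nested. Truncation: an inequality $ax\le b$, with hyperplane $H=\{ax=b\}$, truncates a polyhedron $Q$ at a face $F$ if $F\subset\{ax>b\}$; every face $F'$ of $Q$ with $F'\cap F\neq\emptyset$ and $F'\not\subseteq F$ meets $H$; and every face $F'$ of $Q$ with $F'\cap F=\emptyset$ lies in $\{ax<b\}$. The truncation is $Q\cap\{ax\le b\}$. In the repeated truncation, $Q_0=P$, and $Q_j$ is the truncation of $Q_{j-1}$ at its face $F_{I_j}\cap Q_{j-1}$ by an inequality of the form $v_{I_j}\cdot x\le b$. *)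

(* Defs.v *)
From HB Require Import structures.
From mathcomp Require Import all_boot all_order all_algebra.
From mathcomp Require Import boolp classical_sets functions cardinality reals.

Set Implicit Arguments.
Unset Strict Implicit.
Unset Printing Implicit Defensive.

Import Order.TTheory GRing.Theory Num.Theory.
Local Open Scope classical_set_scope.
Local Open Scope ring_scope.

Section Polyhedra.
Context {R : realType} {n : nat}.
Implicit Types (a v x p : 'rV[R]_n) (b : R) (Q F X : set 'rV[R]_n).

Definition dot a x : R := \sum_i a 0 i * x 0 i.

Definition polyhedron Q : Prop :=
  exists (m : nat) (a : 'I_m -> 'rV[R]_n) (b : 'I_m -> R),
    Q = [set x | forall i, dot (a i) x <= b i].

(* Both Q itself (a = 0, b = 0) and the empty set (a = 0, b = 1) are faces. *)
Definition face Q F : Prop :=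
  exists a b, (forall x, Q x -> dot a x <= b) /\
              F = Q `&` [set x | dot a x = b].

(* X is nonempty and its affine hull has dimension d: the row space of U is
   the smallest linear subspace containing all differences x - p, x in X. *)
Definition affine_dim X (d : nat) : Prop :=
  exists p (U : 'M[R]_n),
    [/\ X p,
        \rank U = d,
        forall x, X x -> (x - p <= U)%MS
      & forall W : 'M[R]_n,
          (forall x, X x -> (x - p <= W)%MS) -> (U <= W)%MS].

Definition codim X (k : nat) : Prop :=
  exists2 d, affine_dim X d & (d + k)%N = n.

Definition facet Q : set (set 'rV[R]_n) := [set F | face Q F /\ codim F 1].

Definition simple_polyhedron Q : Prop :=
  [/\ polyhedron Q,
      codim Q 0
    & forall F (k : nat), face Q F -> codim F k ->
        ([set G | facet Q G /\ F `<=` G] #= `I_k)%card].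

Definition normal_cone Q F : set 'rV[R]_n :=
  [set v | forall y, F y -> forall x, Q x -> dot x v <= dot y v].

Definition normal_fan Q : set (set 'rV[R]_n) :=
  [set K | exists F, [/\ face Q F, F !=set0 & K = normal_cone Q F]].

Definition normal_vector Q F v : Prop :=
  v != 0 /\ normal_cone Q F = [set t *: v | t in [set t : R | 0 <= t]].

(* The inequality dot a x <= b truncates Q at its face F. *)
Definition truncates Q F a b : Prop :=
  [/\ face Q F,
      F `<=` [set x | b < dot a x],
      forall F', face Q F' -> F' `&` F !=set0 -> ~ (F' `<=` F) ->
        F' `&` [set x | dot a x = b] !=set0
    & forall F', face Q F' -> F' `&` F = set0 ->
        F' `<=` [set x | dot a x < b]].

Definition truncation Q a b : set 'rV[R]_n := Q `&` [set x | dot a x <= b].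

End Polyhedra.

Section Complexes.
Implicit Types T U : finType.

(* A simplicial complex on (a subset of) T is given by its set of simplices;
   t is a vertex when the singleton of t is a simplex. *)
Definition vertices T (K : set {set T}) : set T := [set t | K [set t]%SET].

Definition complex_iso T U (K : set {set T}) (L : set {set U}) : Prop :=
  exists f : T -> U,
    set_bij (vertices K) (vertices L) f /\
    forall A : {set T}, (forall t, t \in A -> vertices K t) ->
      (K A <-> L (f @: A)%SET).

Definition building_set T (K : set {set T}) (B : {set {set T}}) : Prop :=
  [/\ forall I, I \in B -> I != finset.set0 /\ K I,
      forall s : T, [set s]%SET \in B
    & forall I J : {set T}, I \in B -> J \in B ->
        (I :&: J)%SET != finset.set0 -> K (I :|: J)%SET -> (I :|: J)%SET \in B].

Definition antichain T (X : {set {set T}}) : Prop :=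
  forall I J : {set T}, I \in X -> J \in X -> I != J -> ~~ (I \subset J).

Definition nested T (K : set {set T}) (B : {set {set T}}) :
    set {set {set T}} :=
  [set N | N \subset B /\
     forall X : {set {set T}}, X \subset N -> antichain X -> (2 <= #|X|)%N ->
       K (finset.cover X) /\ finset.cover X \notin B].

End Complexes.

Section Nestohedra.
Context {R : realType} {n : nat}.
Implicit Types (S : finType) (P Q : set 'rV[R]_n).

Definition facet_labelling S Q (F : S -> set 'rV[R]_n) : Prop :=
  set_bij [set: S] (facet Q) F.

(* F_I; for I empty this is Q. *)
Definition facet_meet S Q (F : S -> set 'rV[R]_n) (I : {set S}) :
    set 'rV[R]_n :=
  Q `&` [set x | forall s, s \in I -> F s x].

Definition dual_complex S Q (F : S -> set 'rV[R]_n) : set {set S} :=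
  [set I | facet_meet Q F I !=set0].

(* Q is a nestohedron of the building set B of the complex K. *)
Definition nestohedron S (K : set {set S}) (B : {set {set S}}) Q : Prop :=
  simple_polyhedron Q /\
  exists (T : finType) (G : T -> set 'rV[R]_n),
    facet_labelling Q G /\ complex_iso (dual_complex Q G) (nested K B).

Definition sum_vec S (v : S -> 'rV[R]_n) (I : {set S}) : 'rV[R]_n :=
  \sum_(i in I) v i.

Definition nested_cone S (v : S -> 'rV[R]_n) (N : {set {set S}}) :
    set 'rV[R]_n :=
  [set x | exists c : {set S} -> R,
     (forall I, I \in N -> 0 <= c I) /\ x = \sum_(I in N) c I *: sum_vec v I].

Definition nested_fan S (v : S -> 'rV[R]_n) (K : set {set S})
    (B : {set {set S}}) : set (set 'rV[R]_n) :=
  [set nested_cone v N | N in nested K B].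

(* Q' is obtained from Q by successive truncations along the list Is, each at
   the intersection of the current polyhedron with a face F_I of the fixed
   polyhedron P; the right-hand sides b are free at each step. *)
Fixpoint repeated_truncation S P (F : S -> set 'rV[R]_n) (v : S -> 'rV[R]_n)
    Q (Is : seq {set S}) (Q' : set 'rV[R]_n) : Prop :=
  if Is is J :: Js then
    exists b, truncates Q (facet_meet P F J `&` Q) (sum_vec v J) b /\
      repeated_truncation P F v (truncation Q (sum_vec v J) b) Js Q'
  else Q' = Q.

Definition descending_listing S (B : {set {set S}}) (Is : seq {set S}) : Prop :=
  [/\ uniq Is, Is =i B
    & sorted (fun I J : {set S} => (#|J| <= #|I|)%N) Is].

End Nestohedra.

(* Main.v *)
Require Import Defs.
From mathcomp Require Import all_boot all_order all_algebra.
From mathcomp Require Import boolp classical_sets functions cardinality reals.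
From mathcomp Require Import lra.

(** Present a simple polyhedron by a system of inequalities, one per facet, in
  which the normals tight at any point are linearly independent.  Faces, normal
  cones and the dual complex of such a system can be read off from the tight
  sets.  Truncating the face with tight set [A] by [w_j = \sum_(i in A) w_i] adds
  one inequality (or, when [A] is the singleton of [j], only shifts it), keeps
  tight normals independent, and replaces the dual complex by its stellar
  subdivision at [A].  After truncating along an initial segment of the list, the
  sets listed so far and the singletons again form a building set, and passing
  from one such building set to the next subdivides the nested complex in the
  same way: a new set [J] subdivides the simplex of the singletons of [J]. *)

Set Implicit Arguments.
Unset Strict Implicit.
Unset Printing Implicit Defensive.

Import Order.TTheory GRing.Theory Num.Theory.
Local Open Scope classical_set_scope.
Local Open Scope ring_scope.

(** * Dot products and linear independence *)

Section DotProduct.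
Context {R : realType} {n : nat}.
Implicit Types (a d x y : 'rV[R]_n).

(** The index type never changes: constraints are indexed by subsets of [S], with normals
    [sum_vec v I], and a facet of [P] is indexed by a singleton. A truncation then alters only the
    active set and the right-hand sides, and the induction carries an equivalence between two
    complexes on one type, [pcomplex] and [nested]. With independent tight normals, simplicity,
    facets and normal fan of the result all follow from it. Since every [b] allowed by [truncates]
    must be handled, the subdivision step uses only the clauses of [truncates]; that some [b] exists
    is a separate matter. The obstacle there is that [P] may be unbounded or have no vertex, so one
    representative point per tight set takes the place of the vertices. The descending order also
    ensures that, when [J] is reached, the facets labelled by its elements have not been shifted
    yet. *)

Lemma dotC a x : dot a x = dot x a.
Proof. by apply: eq_bigr => i _; rewrite mulrC. Qed.

Lemma dotDr a x y : dot a (x + y) = dot a x + dot a y.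
Proof. by rewrite -big_split; apply: eq_bigr => i _; rewrite mxE mulrDr. Qed.

Lemma dotZr a x (t : R) : dot a (t *: x) = t * dot a x.
Proof. by rewrite mulr_sumr; apply: eq_bigr => i _; rewrite mxE mulrCA. Qed.

Lemma dotNr a x : dot a (- x) = - dot a x.
Proof. by rewrite -scaleN1r dotZr mulN1r. Qed.

Lemma dotBr a x y : dot a (x - y) = dot a x - dot a y.
Proof. by rewrite dotDr dotNr. Qed.

Lemma dotDl a x y : dot (x + y) a = dot x a + dot y a.
Proof. by rewrite dotC dotDr !(dotC a). Qed.

Lemma dotZl a x (t : R) : dot (t *: x) a = t * dot x a.
Proof. by rewrite dotC dotZr dotC. Qed.

Lemma dot0l a : dot 0 a = 0.
Proof. by rewrite -(scale0r 0) dotZl mul0r. Qed.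

Lemma dot_suml (I : Type) (r : seq I) (p : pred I) (E : I -> 'rV[R]_n) a :
  dot (\sum_(i <- r | p i) E i) a = \sum_(i <- r | p i) dot (E i) a.
Proof.
elim/big_rec2: _ => [|i y z _ IH]; first by rewrite dot0l.
by rewrite dotDl IH.
Qed.

Lemma dot_self_gt0 a : a != 0 -> 0 < dot a a.
Proof.
move=> a0; have dd0 : 0 <= dot a a by apply: sumr_ge0 => i _; exact: sqr_ge0.
rewrite lt_neqAle dd0 andbT eq_sym; apply: contraNneq a0 => /eqP.
rewrite psumr_eq0 => [/allP z|i _]; last exact: sqr_ge0.
apply/eqP/rowP => i; rewrite mxE.
have /implyP/(_ isT) := z i (mem_index_enum _).
by rewrite mulf_eq0 orbb => /eqP.
Qed.

End DotProduct.

Lemma small_step (R : realType) (J : finType) (A : {set J}) (a c : J -> R) :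
  (forall i, i \in A -> 0 < a i) ->
  exists2 e : R, 0 < e & forall i, i \in A -> e * c i < a i.
Proof.
(* The sum dominates each single ratio, so no maximum over [A] is needed; the summand 1 makes [m]
   positive and the final inequality strict. *)
move=> a0; pose m := 1 + \sum_(i in A) `|c i| / a i.
have m0 : 0 < m.
  by rewrite ltr_pwDl // sumr_ge0 // => i iA; rewrite divr_ge0 // ltW // a0.
exists m^-1; rewrite ?invr_gt0 // => i iA.
rewrite mulrC ltr_pdivrMr // (le_lt_trans (ler_norm _)) //.
rewrite mulrC -ltr_pdivrMr ?a0 //.
rewrite /m (bigD1 i) //= addrCA ltrDl ltr_pwDl // sumr_ge0 // => k /andP[kA _].
by rewrite divr_ge0 // ltW // a0.
Qed.

Lemma card_eq_finset (T : finType) (A : {set T}) :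
  ([set i | i \in A] #= `I_#|A|)%card.
Proof.
apply/card_set_bijP; exists (index^~ (enum A)); split=> [i iA|i j|k /= kA].
- by rewrite /= cardE index_mem mem_enum.
- rewrite !inE /= => iA jA ij.
  by rewrite -(nth_index i (_ : i \in enum A)) ?ij ?nth_index ?mem_enum.
- have [i iA <-] : exists2 i, i \in A & index i (enum A) = k.
    exists (enum_val (Ordinal kA)); first exact: enum_valP.
    have [x0 _] : exists x0, x0 \in A.
      by exists (enum_val (Ordinal kA)); exact: enum_valP.
    by rewrite (enum_val_nth x0) index_uniq ?enum_uniq // -cardE.
  by exists i.
Qed.

Section LinearSystems.
Context {R : realType} {n : nat} {I : finType} (w : I -> 'rV[R]_n).
Implicit Types (A D N : {set I}) (h c : I -> R) (u d x y z : 'rV[R]_n).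

Definition indep A := forall c, \sum_(i in A) c i *: w i = 0 ->
  forall i, i \in A -> c i = 0.

Definition cone A : set 'rV[R]_n :=
  [set x | exists c, (forall i, i \in A -> 0 <= c i) /\
                     x = \sum_(i in A) c i *: w i].

Lemma indepS A N : A \subset N -> indep N -> indep A.
Proof.
move=> AN indN c c0 i iA.
pose c' k := if k \in A then c k else 0.
have := indN c'; rewrite (big_setID A) /= (finset.setIidPr AN).
rewrite [X in _ + X]big1 ?addr0; last first.
  by move=> k; rewrite inE /c' => /andP[/negbTE->]; rewrite scale0r.
rewrite (eq_bigr (fun i => c i *: w i)) => [/(_ c0 i)|k]; last first.
  by rewrite /c' => ->.
by rewrite /c' iA; apply; apply: (fintype.subsetP AN).
Qed.

Definition rows A : 'M[R]_(#|A|, n) := \matrix_k w (enum_val k).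

Lemma mul_rows A (f : 'rV_#|A|) :
  f *m rows A = \sum_k f 0 k *: w (enum_val k).
Proof.
by rewrite mulmx_sum_row; apply: eq_bigr => k _; rewrite rowK.
Qed.

Lemma rows_trE A x k : (x *m (rows A)^T) 0 k = dot (w (enum_val k)) x.
Proof. by rewrite mxE; apply: eq_bigr => j _; rewrite !mxE mulrC. Qed.

Lemma orth_rowsP A x :
  reflect (forall i, i \in A -> dot (w i) x = 0) (x <= kermx (rows A)^T)%MS.
Proof.
apply: (iffP sub_kermxP) => [x0 i iA|x0].
  by rewrite -(enum_rankK_in iA iA) -rows_trE x0 mxE.
by apply/rowP => k; rewrite rows_trE mxE x0 ?enum_valP.
Qed.

Lemma rank_orth_rows A :
  (\rank (kermx (rows A)^T) + \rank (rows A))%N = n.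
Proof. by rewrite mxrank_ker mxrank_tr subnK // rank_leq_col. Qed.

Lemma coords_sum A (f : 'rV_#|A|) :
  exists c, f *m rows A = \sum_(i in A) c i *: w i /\
            forall k, c (enum_val k) = f 0 k.
Proof.
exists (fun i => odflt 0 (omap (fun k => f 0 k) [pick k | enum_val k == i])).
have E k : odflt 0 (omap (fun k => f 0 k)
    [pick k' | enum_val k' == enum_val k :> I]) = f 0 k.
  case: pickP => [k' /eqP/enum_val_inj -> //|/(_ k)]; by rewrite eqxx.
split => //; rewrite mul_rows [RHS]big_enum_val /=.
by apply: eq_bigr => k _; rewrite E.
Qed.

Lemma indep_rank A : indep A <-> \rank (rows A) = #|A|.
Proof.
split=> [indA|/eqP rk].
- apply/eqP; change (row_free (rows A)); apply: inj_row_free => f f0.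
  have [c [fc cE]] := coords_sum f.
  rewrite fc in f0; apply/rowP => k; rewrite -cE mxE.
  exact: indA f0 _ (enum_valP k).
- move=> c c0 i iA; rewrite -(enum_rankK_in iA iA).
  set k := enum_rank_in _ _; pose f := \row_k c (enum_val k : I) : 'rV_#|A|.
  suff /rowP/(_ k) : f = 0 by rewrite !mxE.
  apply/eqP; rewrite -(mulmx_free_eq0 f rk) mul_rows -[X in _ == X]c0.
  by rewrite [X in _ == X]big_enum_val; apply/eqP/eq_bigr => l _; rewrite mxE.
Qed.

Lemma indep_solve A (g : I -> R) : indep A ->
  exists d, forall i, i \in A -> dot (w i) d = g i.
Proof.
move=> /indep_rank/eqP/row_freeP[M MV].
pose d := (M *m \col_k g (enum_val k))^T.
exists d => i iA; rewrite -(enum_rankK_in iA iA) -rows_trE.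
by rewrite /d -trmx_mul mulmxA MV mul1mx !mxE.
Qed.

(** A span is its own double orthogonal complement: the columns of [cokermx] are orthogonal to all
    rows, and a vector killed by them lies in the row space. *)
Lemma span_of_orth A u :
  (forall d, (forall i, i \in A -> dot (w i) d = 0) -> dot u d = 0) ->
  exists c, u = \sum_(i in A) c i *: w i.
Proof.
move=> orth; suff /submxP[f ->] : (u <= rows A)%MS.
  by have [c [-> _]] := coords_sum f; exists c.
rewrite submxE; apply/eqP/rowP => k; rewrite [RHS]mxE.
have /orth ud : forall i, i \in A -> dot (w i) (col k (cokermx (rows A)))^T = 0.
  move=> i iA; rewrite -(enum_rankK_in iA iA).
  have /matrixP/(_ (enum_rank_in iA i) k) := mulmx_coker (rows A).
  by rewrite !mxE => E; rewrite -[RHS]E; apply: eq_bigr => j _; rewrite !mxE.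
by rewrite -[RHS]ud mxE; apply: eq_bigr => j _; rewrite !mxE.
Qed.

End LinearSystems.

(** * Systems of linear inequalities *)

Lemma affine_dim_uniq (R : realType) (n : nat) (X : set 'rV[R]_n) d1 d2 :
  affine_dim X d1 -> affine_dim X d2 -> d1 = d2.
Proof.
have W e1 e2 : affine_dim X e1 -> affine_dim X e2 -> (e1 <= e2)%N.
  move=> [p1 [U1 [Xp1 <- _ min1]]] [p2 [U2 [_ <- XU2 _]]].
  apply: mxrankS; apply: min1 => x Xx.
  have -> : x - p1 = (x - p2) - (p1 - p2) by rewrite opprB addrA subrK.
  by rewrite addmx_sub ?eqmx_opp ?XU2.
by move=> a1 a2; apply/eqP; rewrite eqn_leq !W.
Qed.

Section InequalitySystems.
Context {R : realType} {n : nat} {I : finType} (w : I -> 'rV[R]_n).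
Implicit Types (A D N : {set I}) (h c : I -> R) (u d x y z : 'rV[R]_n).

Definition sys D h : set 'rV[R]_n :=
  [set x | forall i, i \in D -> dot (w i) x <= h i].

Definition tight D h x : {set I} := [set i in D | dot (w i) x == h i]%SET.

Definition sface D h A : set 'rV[R]_n :=
  sys D h `&` [set x | A \subset tight D h x].

Definition pcomplex D h : set {set I} := [set A | sface D h A !=set0].

(** Simplicity in linear terms: the codimension of the face at [x] is the rank of the tight normals,
    and independence makes it the number of tight constraints. *)
Definition indep_tight D h :=
  forall x, sys D h x -> indep w (tight D h x).

Lemma tight_sub D h x : tight D h x \subset D.
Proof. by apply/fintype.subsetP => i; rewrite inE => /andP[]. Qed.

Lemma in_tight D h x i : i \in tight D h x -> dot (w i) x = h i.
Proof. by rewrite inE => /andP[_ /eqP]. Qed.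

Lemma sub_tight D h A x : A \subset D ->
  reflect (forall i, i \in A -> dot (w i) x = h i) (A \subset tight D h x).
Proof.
move=> AD; apply: (iffP fintype.subsetP) => [At i /At/in_tight //|At i iA].
by rewrite inE (fintype.subsetP AD) //= At.
Qed.

Lemma pcomplex_sub D h A : pcomplex D h A -> A \subset D.
Proof.
by move=> [x [_ /= Ax]]; apply: fintype.subset_trans Ax (tight_sub D h x).
Qed.

Lemma pcomplexS D h A N : A \subset N -> pcomplex D h N -> pcomplex D h A.
Proof.
move=> AN [x [sx /= Nx]]; exists x; split=> //=.
exact: fintype.subset_trans Nx.
Qed.

Lemma sysP_lt D h x i : sys D h x -> i \in D -> i \notin tight D h x ->
  dot (w i) x < h i.
Proof.
by move=> sx iD; rewrite inE iD /= lt_neqAle => ->; rewrite sx.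
Qed.

(** [small_step] keeps slack constraints slack; a tight constraint reacts only to the sign of
    [dot (w i) d], whatever the length of the step. *)
Lemma move_tight D h x d : sys D h x ->
  (forall i, i \in tight D h x -> dot (w i) d <= 0) ->
  exists2 e : R, 0 < e & sys D h (x + e *: d) /\
    tight D h (x + e *: d) = [set i in tight D h x | dot (w i) d == 0]%SET.
Proof.
move=> sx xd.
have [i|e e0 He] := @small_step R I (D :\: tight D h x)%SET
    (fun i => h i - dot (w i) x) (fun i => dot (w i) d).
  by rewrite inE => /andP[it iD]; rewrite subr_gt0 (sysP_lt sx).
have lt i : i \in D -> i \notin tight D h x -> dot (w i) (x + e *: d) < h i.
  by move=> iD it; rewrite dotDr dotZr -ltrBrDl He // inE it.
exists e => //; split.
- move=> i iD; have [it|it] := boolP (i \in tight D h x); last exact/ltW/lt.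
  rewrite dotDr dotZr (in_tight it) gerDl pmulr_rle0 //; exact: xd.
- apply/setP => i; rewrite [LHS]inE [RHS]inE.
  have [it|it] := boolP (i \in tight D h x).
    have iD := fintype.subsetP (tight_sub D h x) _ it.
    rewrite iD /= dotDr dotZr (in_tight it) addrC -subr_eq0 addrK mulf_eq0.
    by rewrite (gt_eqF e0).
  by have [iD|//] := boolP (i \in D); rewrite (lt_eqF (lt _ iD it)).
Qed.

(** Independence allows the change of each tight constraint to be prescribed separately: 0 on [A]
    and -1 elsewhere releases exactly the constraints outside [A]. The result is a relative interior
    point of the face. *)
Lemma sface_exact D h A : indep_tight D h -> pcomplex D h A ->
  exists2 z, sys D h z & tight D h z = A.
Proof.
move=> ind [x [sx /= Ax]].
have [d dE] := indep_solve (fun i => - (i \notin A)%:R) (ind x sx).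
have [|e e0 [se te]] := @move_tight D h x d sx.
  by move=> i it; rewrite dE // oppr_le0 ler0n.
exists (x + e *: d) => //; rewrite te; apply/setP => i; rewrite inE.
have [it|it] := boolP (i \in tight D h x); last first.
  by apply/esym; apply: contraNF it => /(fintype.subsetP Ax).
by rewrite dE // oppr_eq0 pnatr_eq0 eqb0 negbK.
Qed.

Lemma sface_cone D h A c x0 : A \subset D -> (forall i, i \in A -> 0 < c i) ->
  sys D h x0 -> A \subset tight D h x0 ->
  forall x, sys D h x ->
    dot (\sum_(i in A) c i *: w i) x <= dot (\sum_(i in A) c i *: w i) x0
    ?= iff (A \subset tight D h x).
Proof.
move=> AD c0 sx0 Ax0 x sx; rewrite !dot_suml.
suff -> : (A \subset tight D h x) =
    [forall (i | i \in A), dot (c i *: w i) x == dot (c i *: w i) x0].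
  apply: leif_sum => i iA; rewrite /Order.leif !dotZl ler_pM2l ?c0 //.
  by rewrite (in_tight (fintype.subsetP Ax0 i iA)) sx ?(fintype.subsetP AD).
apply/(sub_tight _ _ AD)/forall_inP => [xA i iA|xA i iA].
  by rewrite !dotZl xA // (in_tight (fintype.subsetP Ax0 i iA)).
have ci : c i != 0 by rewrite gt_eqF ?c0.
have := xA i iA; rewrite !dotZl (inj_eq (mulfI ci)) => /eqP ->.
exact/in_tight/(fintype.subsetP Ax0).
Qed.

Lemma face_sface D h A : A \subset D -> face (sys D h) (sface D h A).
Proof.
move=> AD; exists (\sum_(i in A) w i), (\sum_(i in A) h i).
have le x : sys D h x -> dot (\sum_(i in A) w i) x <= \sum_(i in A) h i
    ?= iff (A \subset tight D h x).
  move=> sx; rewrite dot_suml.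
  suff -> : (A \subset tight D h x) =
      [forall (i | i \in A), dot (w i) x == h i].
    by apply: leif_sum => i iA; rewrite /Order.leif sx // (fintype.subsetP AD).
  by apply/(sub_tight _ _ AD)/forall_inP => xA i iA; apply/eqP/xA.
split; first by move=> x /le[].
by apply/seteqP; split=> x [sx /= xA]; split=> //=;
  [apply/eqP; rewrite (le x sx) | rewrite -(le x sx); apply/eqP].
Qed.

(** The direction space is the orthogonal complement of the tight normals. It cannot be smaller,
    since a short step along any of its vectors stays in the face. *)
Lemma affine_dim_sface D h x : sys D h x ->
  affine_dim (sface D h (tight D h x)) (\rank (kermx (rows w (tight D h x))^T)).
Proof.
move=> sx; exists x, (kermx (rows w (tight D h x))^T); split => //.
- by split=> /=.
- by move=> y [sy /= yt]; apply/orth_rowsP => i it;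
    rewrite dotBr !(@in_tight D h) ?subrr //; apply: (fintype.subsetP yt).
- move=> W WX; apply/row_subP => k.
  set d := row k _.
  have dE : forall i, i \in tight D h x -> dot (w i) d = 0.
    by apply/orth_rowsP; exact: row_sub.
  have [i it|e e0 [se te]] := @move_tight D h x d sx; first by rewrite dE.
  have : (e *: d <= W)%MS.
    rewrite -(addKr x (e *: d)) addrC; apply: WX; split=> //=.
    by rewrite te; apply/fintype.subsetP => i it; rewrite inE it dE ?eqxx.
  by rewrite eqmx_scale ?gt_eqF.
Qed.

Lemma codim_sface D h x k : sys D h x ->
  codim (sface D h (tight D h x)) k <-> k = \rank (rows w (tight D h x)).
Proof.
move=> sx; have dimx := affine_dim_sface sx.
have E := rank_orth_rows w (tight D h x).
split=> [[d /affine_dim_uniq/(_ dimx) ->] Ek|->]; last by eexists; [exact: dimx|].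
by apply/eqP; rewrite -(eqn_add2l (\rank (kermx (rows w (tight D h x))^T))) Ek E.
Qed.

(* With independent tight normals, a dual basis replaces Farkas' lemma. *)
Lemma max_in_cone D h x u : indep_tight D h -> sys D h x ->
  (forall y, sys D h y -> dot u y <= dot u x) -> cone w (tight D h x) u.
Proof.
move=> ind sx umax.
have le d : (forall i, i \in tight D h x -> dot (w i) d <= 0) -> dot u d <= 0.
  move=> /(move_tight sx)[e e0 [/umax + _]].
  by rewrite dotDr dotZr gerDl pmulr_rle0.
have [d d0|c cE] := @span_of_orth R n I w (tight D h x) u.
  apply/eqP; rewrite eq_le le => [|i it]; last by rewrite d0.
  rewrite -oppr_le0 -dotNr le // => i it; by rewrite dotNr d0 // oppr0.
exists c; split=> // i it.
have [d dE] := indep_solve (fun j => - (j == i)%:R) (ind x sx).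
have /le : forall j, j \in tight D h x -> dot (w j) d <= 0.
  by move=> j jt; rewrite dE // oppr_le0 ler0n.
rewrite cE dot_suml (bigD1 i) //= big1 ?addr0; last first.
  by move=> j /andP[jt /negbTE ji]; rewrite dotZl dE // ji oppr0 mulr0.
by rewrite dotZl dE // eqxx mulrN1 oppr_le0.
Qed.

(** At a point of the face, its functional [a] is a nonnegative combination of tight normals; [a] is
    maximal exactly where all constraints with nonzero coefficient are tight. *)
Lemma face_exact D h G : indep_tight D h -> face (sys D h) G -> G !=set0 ->
  exists2 z, sys D h z & G = sface D h (tight D h z).
Proof.
move=> ind [a [b [ab ->]]] [x [sx /= xb]].
have [y sy|c [c0 aE]] := @max_in_cone D h x a ind sx; first by rewrite xb ab.
pose A := [set i in tight D h x | c i != 0]%SET.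
have Ax : A \subset tight D h x.
  by apply/fintype.subsetP => i; rewrite inE => /andP[].
have [|z sz zA] := @sface_exact D h A ind; first by exists x.
exists z => //; rewrite zA.
have aA : a = \sum_(i in A) c i *: w i.
  rewrite aE (big_setID A) /= (finset.setIidPr Ax) [X in _ + X]big1 ?addr0 //.
  by move=> i /finset.setDP[it]; rewrite inE it negbK => /eqP->; rewrite scale0r.
have cA i : i \in A -> 0 < c i.
  by rewrite inE => /andP[it ci]; rewrite lt_neqAle eq_sym ci c0.
have le := sface_cone (fintype.subset_trans Ax (tight_sub D h x)) cA sx Ax.
apply/seteqP; split => y [sy /= yA]; split => //=.
  by rewrite -(le y sy) -aA yA xb.
by apply/eqP; rewrite -xb aA (le y sy).
Qed.

End InequalitySystems.

(** * Systems with independent tight normals *)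

Section SimpleSystems.
Context {R : realType} {n : nat} {I : finType} (w : I -> 'rV[R]_n).
Implicit Types (A D N : {set I}) (h c : I -> R) (u d x y z : 'rV[R]_n).

Lemma sys_polyhedron D h : polyhedron (sys w D h).
Proof.
exists #|D|, (fun k => w (enum_val k)), (fun k => h (enum_val k)).
apply/seteqP; split=> x sx; first by move=> k; apply/sx/enum_valP.
by move=> i iD; have := sx (enum_rank_in iD i); rewrite enum_rankK_in.
Qed.

Lemma codim_nonempty (X : set 'rV[R]_n) k : codim X k -> X !=set0.
Proof. by move=> [d [p [U [Xp _ _ _]]] _]; exists p. Qed.

Lemma sface_sub_exact D h A z : sys w D h z ->
  sface w D h (tight w D h z) `<=` sface w D h A <-> A \subset tight w D h z.
Proof.
move=> sz; split=> [sub|Az x [sx /= zx]].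
  by have [] : sface w D h A z by apply: sub; split=> /=.
by split=> //=; apply: fintype.subset_trans Az zx.
Qed.

Lemma codim_sface_indep D h z k : indep_tight w D h -> sys w D h z ->
  codim (sface w D h (tight w D h z)) k <-> k = #|tight w D h z|.
Proof.
move=> ind sz; have /indep_rank <- := ind z sz; exact: codim_sface.
Qed.

Lemma sface0 D h : sface w D h finset.set0 = sys w D h.
Proof.
by apply/seteqP; split=> [x []//|x sx]; split=> //=; rewrite finset.sub0set.
Qed.

Lemma pcomplex0 D h : pcomplex w D h finset.set0 <-> sys w D h !=set0.
Proof. by rewrite /pcomplex /= sface0. Qed.

Section Structure.
Variables (D : {set I}) (h : I -> R).
Hypotheses (ind : indep_tight w D h) (ne : sys w D h !=set0).
Hypothesis irr : forall i, i \in D -> pcomplex w D h [set i]%SET.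
Local Notation Q := (sys w D h).
Local Notation F i := (sface w D h [set i]%SET).

Lemma facet_sys : facet Q = [set F i | i in [set i | i \in D]].
Proof.
apply/seteqP; split=> [G [fG cG]|_ [i /= iD <-]].
  have [z sz Gz] := face_exact ind fG (codim_nonempty cG).
  move: cG; rewrite Gz codim_sface_indep // => /esym/eqP/cards1P[i zi].
  exists i; last by rewrite zi.
  by apply: (fintype.subsetP (tight_sub w D h z)); rewrite zi set11.
have [z sz zi] := sface_exact ind (irr iD).
split; first by apply: face_sface; rewrite finset.sub1set.
by rewrite -zi codim_sface_indep // zi cards1.
Qed.

Lemma facet_sys_inj : {in [set i | i \in D] &, injective (fun i => F i)}.
Proof.
move=> i j; rewrite !inE => iD jD eF.
have [z sz zi] := sface_exact ind (irr iD).
have : [set j]%SET \subset tight w D h z.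
  by apply/sface_sub_exact; rewrite // zi eF.
by rewrite zi finset.sub1set inE => /eqP.
Qed.

Lemma sys_simple : simple_polyhedron Q.
Proof.
have p0 : pcomplex w D h finset.set0 by apply/pcomplex0.
split; first exact: sys_polyhedron.
  have [z sz z0] := sface_exact ind p0.
  by rewrite -sface0 -z0 codim_sface_indep // z0 cards0.
move=> G k fG cG; have [z sz Gz] := face_exact ind fG (codim_nonempty cG).
move: cG; rewrite Gz codim_sface_indep // => ->.
suff -> : [set G | facet Q G /\ sface w D h (tight w D h z) `<=` G] =
          [set F i | i in [set i | i \in tight w D h z]].
  apply: card_eq_trans (card_eq_finset _); apply: inj_card_eq.
  move=> i j; rewrite !inE => iz jz; apply: facet_sys_inj; rewrite inE;
  exact: (fintype.subsetP (tight_sub w D h z)).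
rewrite facet_sys; apply/seteqP; split=> [H [[i /= iD <-]]|H [i /= iz <-]].
  by rewrite sface_sub_exact // finset.sub1set; exists i.
split; last by rewrite sface_sub_exact // finset.sub1set.
by exists i => //=; apply: (fintype.subsetP (tight_sub w D h z)).
Qed.

Lemma normal_cone_sface z : Q z ->
  normal_cone Q (sface w D h (tight w D h z)) = cone w (tight w D h z).
Proof.
move=> sz; apply/seteqP; split=> u.
  move=> /(_ z) umax; apply: max_in_cone => // y sy.
  by rewrite !(dotC u) umax //; split=> /=.
move=> [c [c0 ->]] y [sy /= zy] x sx; rewrite !(dotC _ (\sum_(i in _) _)) !dot_suml.
apply: ler_sum => i iz; rewrite !dotZl ler_wpM2l ?c0 //.
rewrite (in_tight (fintype.subsetP zy i iz)) sx //.
exact: (fintype.subsetP (tight_sub w D h z)).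
Qed.

Lemma normal_fan_sys : normal_fan Q = [set cone w A | A in pcomplex w D h].
Proof.
apply/seteqP; split=> [K [G [fG G0 ->]]|_ [A pA <-]].
  have [z sz ->] := face_exact ind fG G0.
  by exists (tight w D h z); rewrite ?normal_cone_sface //; exists z; split=> /=.
have [z sz zA] := sface_exact ind pA.
exists (sface w D h A); rewrite -zA normal_cone_sface //; split=> //.
  by apply: face_sface; exact: tight_sub.
by exists z; split=> /=.
Qed.

Lemma facet_labelling_sys :
  facet_labelling Q (fun t : {i | i \in D} => F (val t)).
Proof.
split=> [t _|t u _ _ /= e|G].
- by rewrite facet_sys; exists (val t) => //=; exact: valP.
- by apply/val_inj/facet_sys_inj; rewrite ?inE //=; exact: valP.
- by rewrite facet_sys => -[i /= iD <-]; exists (exist _ i iD).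
Qed.

Lemma dual_complex_sys (A : {set {i | i \in D}}) :
  dual_complex Q (fun t : {i | i \in D} => F (val t)) A <->
  pcomplex w D h (val @: A)%SET.
Proof.
split=> -[x [sx /= xA]]; exists x; split=> //=.
  apply/fintype.subsetP => _ /imsetP[t tA ->].
  by have [_ /=] := xA t tA; rewrite finset.sub1set.
move=> t tA; split=> //=; rewrite finset.sub1set; apply: (fintype.subsetP xA).
exact: imset_f.
Qed.

Lemma complex_iso_sys :
  complex_iso (dual_complex Q (fun t : {i | i \in D} => F (val t)))
    (pcomplex w D h).
Proof.
exists val; split; last by move=> A _; exact: dual_complex_sys.
have vt (t : {i | i \in D}) : vertices
    (dual_complex Q (fun t : {i | i \in D} => F (val t))) t.
  by apply/dual_complex_sys; rewrite imset_set1; apply/irr/valP.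
split=> [t _|t u _ _ /val_inj //|i pi].
  by apply: irr; exact: valP.
have iD : i \in D by rewrite -finset.sub1set; exact: (pcomplex_sub pi).
by exists (exist _ i iD) => //; exact: vt.
Qed.

End Structure.
End SimpleSystems.

(** * Truncation *)

Section Truncation.
Context {R : realType} {n : nat} {I : finType} (w : I -> 'rV[R]_n).
Implicit Types (A D N : {set I}) (h c : I -> R) (u d x y z : 'rV[R]_n).

(** The ratio test of the simplex method: among the constraints that increase along [d], the one
    with least ratio [r i] is reached first. *)
Lemma sys_ray_hits D h x d : sys w D h x ->
  (forall i, i \in tight w D h x -> dot (w i) d = 0) ->
  (exists2 i, i \in D & 0 < dot (w i) d) ->
  exists2 t : R, 0 <= t & sys w D h (x + t *: d) /\
    tight w D h x \proper tight w D h (x + t *: d).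
Proof.
move=> sx xd [i0 i0D i0d].
pose r i := (h i - dot (w i) x) / dot (w i) d.
have [|i /andP[iD id] imin] :=
    @Order.TotalTheory.arg_minP _ _ _ i0
      (fun i => (i \in D) && (0 < dot (w i) d)) r.
  by rewrite i0D i0d.
have r0 : 0 <= r i by rewrite divr_ge0 ?(ltW id) // subr_ge0 sx.
exists (r i) => //; split.
  move=> k kD; rewrite dotDr dotZr; have [kd|kd] := lerP (dot (w k) d) 0.
    by rewrite (le_trans _ (sx k kD)) // gerDl mulr_ge0_le0.
  by rewrite -lerBrDl -ler_pdivlMr // imin // kD kd.
apply/properP; split.
  apply/fintype.subsetP => k kx.
  rewrite inE (fintype.subsetP (tight_sub w D h x)) //=.
  by rewrite dotDr dotZr xd // mulr0 addr0 (in_tight kx).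
exists i; last by apply: contraTN id => /xd ->; rewrite ltxx.
by rewrite inE iD dotDr dotZr /r (divfK (lt0r_neq0 id)) addrC subrK eqxx.
Qed.

(* A bounded functional only takes finitely many values at the points [y]
   produced here, because its value at [y] is determined by the tight set. *)
Lemma sys_climb D h u (C : R) x : sys w D h x ->
  (forall y, sys w D h y -> dot u y <= C) ->
  exists y, [/\ sys w D h y, tight w D h x \subset tight w D h y,
    dot u x <= dot u y &
    exists c, u = \sum_(i in tight w D h y) c i *: w i].
Proof.
(* Induction on the number of slack constraints: while [u] is outside the span of the tight normals,
   some direction orthogonal to them raises [u], and following it makes a new constraint tight. *)
move=> + uC; have [m] := ubnP (#|D| - #|tight w D h x|)%N.
elim: m x => // m IH x lem sx.
have [orth|/existsNP[d /not_implyP[xd ud]]] := pselect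
    (forall d, (forall i, i \in tight w D h x -> dot (w i) d = 0) -> dot u d = 0).
  by exists x; split=> //; exact: span_of_orth.
wlog {ud} ud : d xd / 0 < dot u d.
  move=> W; have [|ud'|ud'] := ltrgtP 0 (dot u d); first exact: W.
    apply: (W (- d)); last by rewrite dotNr oppr_gt0.
    by move=> i ix; rewrite dotNr xd // oppr0.
  by case: ud.
have [ex|nex] := pselect (exists2 i, i \in D & 0 < dot (w i) d).
  have [t t0 [st pt]] := sys_ray_hits sx xd ex.
  have ltm : (#|D| - #|tight w D h (x + t *: d)| < m)%N.
    rewrite ltnS in lem; apply: leq_trans lem; apply: ltn_sub2l (proper_card pt).
    by apply: leq_trans (proper_card pt) (subset_leq_card (tight_sub _ _ _ _)).
  have [y [sy ty uy cy]] := IH _ ltm st.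
  exists y; split=> //; first exact: fintype.subset_trans (proper_sub pt) ty.
  by apply: le_trans uy; rewrite dotDr dotZr lerDl mulr_ge0 // ltW.
(* No constraint stops this ray, so [u] would reach the value [C + 1]. *)
pose t := (C - dot u x + 1) / dot u d.
have t0 : 0 <= t by rewrite divr_ge0 ?(ltW ud) // addr_ge0 // subr_ge0 uC.
have /uC : sys w D h (x + t *: d).
  move=> i iD; rewrite dotDr dotZr (le_trans _ (sx i iD)) // gerDl.
  rewrite mulr_ge0_le0 // leNgt; apply/negP => id; apply: nex; by exists i.
by rewrite dotDr dotZr divfK ?gt_eqF // addrA addrC addrA addrC => ?; lra.
Qed.

(** Once [w j] is expanded, a normal [w a] with [a] in [A] but not in [N] has coefficient [c j]
    alone. So [c j] vanishes, and independence of [N] does the rest. *)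
Lemma indep_stellar A N j : w j = \sum_(i in A) w i -> indep w (N :|: A)%SET ->
  ~~ (A \subset N) -> j \notin N -> indep w (j |: N)%SET.
Proof.
move=> wj ind /subsetPn[a aA aN] jN c; rewrite big_setU1 //= => c0.
pose e i := c j * (i \in A)%:R + (i \in N)%:R * c i.
have e0 : forall i, i \in (N :|: A)%SET -> e i = 0.
  apply: ind; rewrite -[RHS]c0 wj scaler_sumr.
  under [LHS]eq_bigr do rewrite /e scalerDl.
  rewrite big_split /=; congr (_ + _).
    rewrite (big_setID A) /= [X in _ + X]big1 ?addr0; last first.
      by move=> i /finset.setDP[_ /negbTE ->]; rewrite mulr0 scale0r.
    rewrite (finset.setIidPr (finset.subsetUr _ _)).
    by apply: eq_bigr => i ->; rewrite mulr1.
  rewrite (big_setID N) /= [X in _ + X]big1 ?addr0; last first.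
    by move=> i /finset.setDP[_ /negbTE ->]; rewrite mul0r scale0r.
  rewrite (finset.setIidPr (finset.subsetUl _ _)).
  by apply: eq_bigr => i ->; rewrite mul1r.
have cj : c j = 0.
  have := e0 a; rewrite /e inE aA (negbTE aN) mul0r addr0 mulr1; exact.
move=> i; rewrite in_setU1 => /orP[/eqP -> //|iN].
by have := e0 i; rewrite /e cj mul0r add0r inE iN mul1r; exact.
Qed.

Section Step.
Variables (D : {set I}) (h : I -> R) (A : {set I}) (j : I).
Hypotheses (ind : indep_tight w D h) (AD : A \subset D).
Hypotheses (pA : pcomplex w D h A) (wj : w j = \sum_(i in A) w i).
Local Notation Q := (sys w D h).
Local Notation tightQ := (tight w D h).
Local Notation faceQ := (sface w D h).
Local Notation beta := (\sum_(i in A) h i).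

Lemma dot_apex x : Q x -> dot (w j) x <= beta ?= iff (A \subset tightQ x).
Proof.
move=> sx; rewrite wj dot_suml.
suff -> : (A \subset tightQ x) = [forall (i | i \in A), dot (w i) x == h i].
  by apply: leif_sum => i iA; rewrite /Order.leif sx // (fintype.subsetP AD).
by apply/(sub_tight _ _ _ AD)/forall_inP => xA i iA; apply/eqP/xA.
Qed.

Lemma dot_apex_lt x : Q x -> ~~ (A \subset tightQ x) -> dot (w j) x < beta.
Proof.
by move=> sx; rewrite lt_neqAle (dot_apex sx) => ->; rewrite (dot_apex sx).
Qed.

Lemma sfaceI M N : faceQ M `&` faceQ N = faceQ (M :|: N)%SET.
Proof.
apply/seteqP; split=> [x [[sx /= xM] [_ /= xN]]|x [sx /=]].
  by split=> //=; rewrite finset.subUset xM xN.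
by rewrite finset.subUset => /andP[xM xN]; split; split.
Qed.

(** On [Q] the functional [w j] reaches its maximum [beta] exactly on the face of [A]. The cut is
    made at [beta - e], where [e] is below the gap at a representative of each of the finitely many
    tight sets not containing [A]. *)
Lemma truncates_exists : exists b, truncates Q (faceQ A) (w j) b.
Proof.
have /choice[p pE] : forall C : {set I}, exists x,
    (exists2 y, Q y & tightQ y = C) -> Q x /\ tightQ x = C.
  by move=> C; have [[y sy yC]|no] := pselect (exists2 y, Q y & tightQ y = C);
    [exists y | exists 0].
pose Z := [set C : {set I} |
  `[< exists2 y, Q y & tightQ y = C >] && ~~ (A \subset C)]%SET.
have [C|e e0 He] := @small_step R _ Z (fun C => beta - dot (w j) (p C)) (fun=> 1).
  rewrite inE => /andP[/asboolP/pE[sp pC] AC]; rewrite subr_gt0.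
  by apply: dot_apex_lt => //; rewrite pC.
have pb y : Q y -> ~~ (A \subset tightQ y) -> dot (w j) (p (tightQ y)) < beta - e.
  move=> sy Ay; rewrite ltrBrDr addrC -ltrBrDr -[e]mulr1 He // inE Ay andbT.
  by apply/asboolP; exists y.
exists (beta - e); split; first exact: face_sface.
- move=> x [sx /= xA]; rewrite -(eqP (_ : dot (w j) x == beta)) ?(dot_apex sx) //.
  by rewrite ltrBlDr ltrDl.
- move=> G fG [x [Gx xA]].
  have [z sz Gz] := face_exact ind fG (ex_intro _ x Gx); rewrite Gz in Gx *.
  rewrite sface_sub_exact // => /negP Az.
  have [sp pz] := pE (tightQ z) (ex_intro2 _ _ z sz erefl).
  have := pb _ sz Az; set q := p _ in sp pz * => qb.
  have xb : dot (w j) x = beta.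
    by apply/eqP; rewrite (dot_apex xA.1); exact: xA.2.
  (* The segment from [x], at height [beta], to [q], below [beta - e], has height exactly [beta - e]
     at this parameter. *)
  pose t := e / (beta - dot (w j) q).
  have d0 : 0 < beta - dot (w j) q by lra.
  have t01 : 0 <= t <= 1.
    by rewrite divr_ge0 ?(ltW e0) ?(ltW d0) //= ler_pdivrMr // mul1r; lra.
  have tE : t * (beta - dot (w j) q) = e by rewrite divfK // gt_eqF.
  exists (t *: q + (1 - t) *: x); split; last first.
    by rewrite /= dotDr !dotZr xb; lra.
  have cvx i : dot (w i) (t *: q + (1 - t) *: x) =
      t * dot (w i) q + (1 - t) * dot (w i) x by rewrite dotDr !dotZr.
  split=> [i iD|/=].
    rewrite cvx; have := sp i iD; have := Gx.1 i iD; nra.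
  apply/fintype.subsetP => i iz.
  rewrite inE (fintype.subsetP (tight_sub _ _ _ _) _ iz) /=.
  have iq : i \in tightQ q by rewrite pz.
  rewrite cvx (in_tight (fintype.subsetP Gx.2 i iz)) -(in_tight iq).
  by rewrite -mulrDl addrC subrK mul1r.
- move=> G fG GA x Gx.
  have [z sz Gz] := face_exact ind fG (ex_intro _ x Gx).
  rewrite Gz in Gx GA.
  (* Climbing keeps tight constraints tight, so [y] stays in [G] and off the face of [A]. There
     [w j] is in the span of the tight normals, hence has the same value at [y] as at the
     representative [p (tightQ y)]. *)
  have [y sy|y [sy xy uy [c uE]]] := @sys_climb D h (w j) beta x Gx.1.
    by rewrite (dot_apex sy).
  have Ay : ~~ (A \subset tightQ y).
    apply/negP => Ay; suff : (faceQ (tightQ z) `&` faceQ A) y by rewrite GA.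
    by split; split=> //=; apply: fintype.subset_trans xy; exact: Gx.2.
  apply: le_lt_trans uy _.
  have [sp py] := pE (tightQ y) (ex_intro2 _ _ y sy erefl).
  apply: le_lt_trans (pb y sy Ay); rewrite uE !dot_suml ler_sum // => i iy.
  have ip : i \in tightQ (p (tightQ y)) by rewrite py.
  by rewrite !dotZl (in_tight iy) (in_tight ip).
Qed.

Variable b : R.
Hypothesis trunc : truncates Q (faceQ A) (w j) b.
Local Notation h' := (fun i => if i == j then b else h i).
Local Notation Q' := (sys w (j |: D)%SET h').
Local Notation tightQ' := (tight w (j |: D)%SET h').

Lemma b_lt x : faceQ A x -> b < dot (w j) x.
Proof. by case: trunc => _ /(_ x). Qed.

(** If [j] is already in [D], overriding its bound drops the inequality with [h j]. That one is
    implied: [b] is below the value of [w j] at a point of the face of [A], which is at most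
    [h j]. *)
Lemma truncation_sys : truncation Q (w j) b = Q'.
Proof.
have [x xA] := pA.
apply/seteqP; split=> y.
  move=> [sy /= yb] i; rewrite in_setU1; case: eqP => [->|_] //=; exact: sy.
move=> sy; have yb : dot (w j) y <= b by have := sy j; rewrite setU11 eqxx; exact.
split=> // i iD; have := sy i; rewrite in_setU1 iD orbT => /(_ isT).
case: eqP => // ij _; rewrite ij in iD *; apply: le_trans yb _.
apply/ltW/(lt_le_trans (b_lt xA)); exact: xA.1.
Qed.

Lemma not_A_sub x : Q' x -> ~~ (A \subset tightQ x).
Proof.
rewrite -truncation_sys => -[sx /= xb]; apply/negP => xA.
by have := @b_lt x (conj sx xA); rewrite ltNge xb.
Qed.

Lemma tight'_old x N : j \notin N ->
  (N \subset tightQ' x) = (N \subset tightQ x).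
Proof.
move=> jN; apply/fintype.subsetP/fintype.subsetP => sub i iN;
  have := sub i iN;
  have ij : i == j = false by (apply: contraNF jN => /eqP <-).
all: by rewrite !inE ij.
Qed.

Lemma tight'_apex x : dot (w j) x = b ->
  j \in tightQ' x.
Proof. by move=> xb; rewrite !inE eqxx xb eqxx. Qed.

(** The last clause of [truncates] made combinatorial: the faces of [N] and [A] meet in the face of
    [N :|: A], so they are disjoint when this set is not a simplex. *)
Lemma off_apex N x : ~ pcomplex w D h (N :|: A)%SET -> faceQ N x ->
  dot (w j) x < b.
Proof.
move=> no [sx Nx].
have ND := fintype.subset_trans Nx (tight_sub _ _ _ _).
case: trunc => _ _ _ off; apply: (off (faceQ N)) => //; first exact: face_sface.
by rewrite sfaceI; apply/seteqP; split=> // y Ny; apply: no; exists y.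
Qed.

Lemma star_of_apex x N : Q x -> N \subset tightQ x -> dot (w j) x = b ->
  pcomplex w D h (N :|: A)%SET.
Proof.
move=> sx Nx xb; apply: contrapT => no.
by have := off_apex no (conj sx Nx); rewrite xb ltxx.
Qed.

Lemma meets_apex N : pcomplex w D h (N :|: A)%SET -> ~~ (A \subset N) ->
  exists x, [/\ Q x, N \subset tightQ x & dot (w j) x = b].
Proof.
move=> pNA AN; have pN : pcomplex w D h N.
  by apply: pcomplexS pNA; exact: finset.subsetUl.
have [z sz zN] := sface_exact ind pN.
case: trunc => _ _ meets _.
have [|||x [[sx xN] xb]] := meets (faceQ N); last by exists x.
- exact: face_sface (pcomplex_sub pN).
- by rewrite sfaceI.
- by rewrite -zN sface_sub_exact // zN; exact/negP.
Qed.

Lemma sys'_of x : Q x -> dot (w j) x <= b -> Q' x.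
Proof. by move=> sx xb; rewrite -truncation_sys. Qed.

Lemma sys_of' x : Q' x -> Q x /\ dot (w j) x <= b.
Proof. by rewrite -truncation_sys. Qed.

(** When [j] is tight at [x], independence is taken from another point [y], where the old tight
    constraints and all of [A] are tight together; [indep_stellar] then trades [A] for [j]. *)
Lemma indep_tight_truncation : indep_tight w (j |: D)%SET h'.
Proof.
move=> x sx; have [sx0 xb] := sys_of' sx.
set t := tight _ _ _ _.
have old : (t :\ j)%SET \subset tightQ x.
  by rewrite -tight'_old ?finset.subsetDl // !inE eqxx.
have [jt|jt] := boolP (j \in t); last first.
  have -> : t = (t :\ j)%SET.
    by apply/setP => i; rewrite in_setD1; case: eqP => // ->; exact/negbTE.
  exact: indepS old (ind sx0).
have jb : dot (w j) x = b by have := in_tight jt; rewrite eqxx.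
rewrite -(finset.setD1K jt); have [y [sy /= yt]] := star_of_apex sx0 old jb.
apply: (@indep_stellar A) => //; last by rewrite !inE eqxx.
  exact: indepS yt (ind sy).
by apply: contra (not_A_sub sx) => At; apply: fintype.subset_trans old.
Qed.

(** The face of [N] survives for one of two reasons: it meets the hyperplane if [N :|: A] is a
    simplex, and lies strictly on the kept side otherwise. *)
Lemma pcomplex_truncation_old N : j \notin N ->
  pcomplex w (j |: D)%SET h' N <-> pcomplex w D h N /\ ~~ (A \subset N).
Proof.
move=> jN; split=> [[x [sx /= Nx]]|[pN AN]].
  have [sx0 xb] := sys_of' sx; rewrite tight'_old // in Nx; split.
    by exists x; split.
  by apply: contra (not_A_sub sx) => At; apply: fintype.subset_trans Nx.
suff {}[x [sx Nx xb]] :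
    exists x, [/\ Q x, N \subset tightQ x & dot (w j) x <= b].
  by have sx' := sys'_of sx xb; exists x; split=> //=; rewrite tight'_old.
have [pNA|no] := pselect (pcomplex w D h (N :|: A)%SET).
  by have [x [? ? xb]] := meets_apex pNA AN; exists x; split=> //; rewrite xb.
have [x Nx] := pN; exists x; split; [exact: Nx.1|exact: Nx.2|].
exact/ltW/(off_apex no Nx).
Qed.

Lemma pcomplex_truncation_new N : j \notin N ->
  pcomplex w (j |: D)%SET h' (j |: N)%SET <->
  pcomplex w D h (N :|: A)%SET /\ ~~ (A \subset N).
Proof.
move=> jN; split=> [[x [sx /=]]|[pNA AN]].
  rewrite finset.subUset finset.sub1set => /andP[jx]; rewrite tight'_old // => Nx.
  have [sx0 xb] := sys_of' sx; split.
    by apply: star_of_apex Nx _ => //; have := in_tight jx; rewrite eqxx.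
  by apply: contra (not_A_sub sx) => At; apply: fintype.subset_trans Nx.
have [x [sx Nx xb]] := meets_apex pNA AN.
have sx' : Q' x by apply: sys'_of; rewrite ?xb.
exists x; split=> //=; rewrite finset.subUset finset.sub1set tight'_apex //.
by rewrite tight'_old.
Qed.

End Step.
End Truncation.

(** * Simple polyhedra as systems *)

Section RelativeInterior.
Context {R : realType} {n : nat} {I : finType} (w : I -> 'rV[R]_n).
Variables (D : {set I}) (h : I -> R).

Lemma indep_set1 i : w i != 0 -> indep w [set i]%SET.
Proof.
move=> wi c; rewrite big_set1 => /eqP; rewrite scaler_eq0 (negbTE wi) orbF.
by move=> /eqP ci k; rewrite inE => /eqP ->.
Qed.

(** A point with the fewest tight constraints serves as relative interior point: whatever is tight
    at the midpoint of [z] and [y] is tight at both. Midpoints are all the convexity needed. *)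
Lemma min_tight (X : set 'rV[R]_n) : X !=set0 -> X `<=` sys w D h ->
  (forall x y, X x -> X y -> X (2^-1 *: (x + y))) ->
  exists2 z, X z & forall y, X y -> tight w D h z \subset tight w D h y.
Proof.
move=> [x0 Xx0] XD mid.
pose p m := `[< exists2 x, X x & #|tight w D h x| = m >].
have [|m /asboolP[z Xz zm] mmin] := @ex_minnP p.
  by exists #|tight w D h x0|; apply/asboolP; exists x0.
exists z => // y Xy; set x := 2^-1 *: (z + y); have Xx : X x by exact: mid.
have sub : tight w D h x \subset (tight w D h z :&: tight w D h y)%SET.
  apply/fintype.subsetP => i ix.
  have iD := fintype.subsetP (tight_sub _ _ _ _) _ ix.
  have := in_tight ix; rewrite dotZr dotDr !inE iD /=.
  have := XD z Xz i iD; have := XD y Xy i iD.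
  by move=> ? ? ?; apply/andP; split; apply/eqP; lra.
have le : (#|tight w D h z| <= #|tight w D h x|)%N.
  by rewrite zm mmin //; apply/asboolP; exists x.
have xz : tight w D h x = tight w D h z.
  apply/eqP; rewrite eqEcard le andbT.
  exact: fintype.subset_trans sub (finset.subsetIl _ _).
by move: sub; rewrite xz => /fintype.subset_trans; apply; exact: finset.subsetIr.
Qed.

End RelativeInterior.

Lemma face_midpoint (R : realType) (n : nat) (Q G : set 'rV[R]_n) :
  (forall x y, Q x -> Q y -> Q (2^-1 *: (x + y))) -> face Q G ->
  forall x y, G x -> G y -> G (2^-1 *: (x + y)).
Proof.
move=> midQ [a [b [_ ->]]] x y [Qx /= xb] [Qy /= yb]; split; first exact: midQ.
by rewrite /= dotZr dotDr xb yb; lra.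
Qed.

Lemma sys_midpoint (R : realType) (n : nat) (I : finType) (w : I -> 'rV[R]_n)
    D h x y : sys w D h x -> sys w D h y -> sys w D h (2^-1 *: (x + y)).
Proof.
move=> sx sy i iD; rewrite dotZr dotDr.
by have := sx i iD; have := sy i iD; lra.
Qed.

Lemma polyhedron_irredundant (R : realType) (n : nat) (P : set 'rV[R]_n) :
  polyhedron P -> exists (m : nat) (a : 'I_m -> 'rV[R]_n) b (D : {set 'I_m}),
    P = sys a D b /\
    forall i, i \in D -> exists2 y, sys a (D :\ i)%SET b y & b i < dot (a i) y.
Proof.
move=> [m [a [b PE]]]; exists m, a, b.
have P0 : `[< P = sys a [set: 'I_m]%SET b >].
  by apply/asboolP; rewrite PE; apply/seteqP; split=> x sx i; [|apply: sx].
have [D /minsetP[/asboolP PD Dmin] _] :=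
  @minset_exists _ (fun D => `[< P = sys a D b >]) _ P0.
exists D; split=> // i iD; apply: contrapT => no.
suff /Dmin/(_ (finset.subsetDl _ _)) : `[< P = sys a (D :\ i)%SET b >].
  by move=> /setP/(_ i); rewrite !inE eqxx iD.
apply/asboolP; rewrite PD; apply/seteqP; split=> x sx k.
  by rewrite inE => /andP[_ /sx].
move=> kD; have [->|ki] := eqVneq k i; last by apply: sx; rewrite !inE ki.
by rewrite leNgt; apply/negP => lt; apply: no; exists x.
Qed.

Section IrredundantSystems.
Context {R : realType} {n : nat} {I : finType} (a : I -> 'rV[R]_n).
Variables (D : {set I}) (b : I -> R).
Local Notation P := (sys a D b).
Hypothesis irr : forall i, i \in D ->
  exists2 y, sys a (D :\ i)%SET b y & b i < dot (a i) y.
Hypothesis full : codim P 0.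

Lemma irr_neq0 i : i \in D -> a i != 0.
Proof.
move=> iD; have [y _ yi] := irr iD; apply: contraTneq yi => ai.
have [x sx] := codim_nonempty full.
by have := sx i iD; rewrite ai !dot0l leNgt.
Qed.

(** A constraint tight at a point with the fewest tight constraints is tight on all of [P], which
    would put [P] in a hyperplane. *)
Lemma interior_point : exists2 x, P x & tight a D b x = finset.set0.
Proof.
have [z sz zmin] := min_tight (codim_nonempty full)
  (fun x => id) (@sys_midpoint R n I a D b).
exists z => //; apply/setP => i; rewrite [RHS]inE; apply/negbTE/negP => iz.
have PE : P = sface a D b (tight a D b z).
  by apply/seteqP; split=> [y sy|y []//]; split=> //=; exact: zmin.
have : codim (sface a D b (tight a D b z)) 0 by rewrite -PE.
rewrite codim_sface // => /esym/eqP; rewrite mxrank_eq0 => /eqP/matrixP r0.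
have := irr_neq0 (fintype.subsetP (tight_sub _ _ _ _) _ iz).
rewrite -(enum_rankK_in iz iz) -(rowK (fun k => a (enum_val k))).
rewrite -/(rows a _); apply/negP; rewrite negbK; apply/eqP/rowP => j.
by rewrite !mxE; have := r0 (enum_rank_in iz i) j; rewrite !mxE.
Qed.

Lemma irr_exact i : i \in D -> exists2 z, P z & tight a D b z = [set i]%SET.
Proof.
move=> iD; have [x sx x0] := interior_point; have [y sy yi] := irr iD.
have lt k : k \in D -> dot (a k) x < b k.
  by move=> kD; apply: (sysP_lt sx kD); rewrite x0 inE.
have xi := lt i iD.
(* Where the segment from the interior point [x] to [y], which violates constraint [i] only, crosses
   the hyperplane of [i], all other constraints are still slack. *)
pose t := (b i - dot (a i) x) / (dot (a i) y - dot (a i) x).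
have d0 : 0 < dot (a i) y - dot (a i) x by lra.
have t0 : 0 < t by rewrite divr_gt0 // subr_gt0.
have t1 : t < 1 by rewrite ltr_pdivrMr // mul1r; lra.
have tE : t * (dot (a i) y - dot (a i) x) = b i - dot (a i) x.
  by rewrite divfK // gt_eqF.
pose z := t *: y + (1 - t) *: x.
have zE k : dot (a k) z = t * dot (a k) y + (1 - t) * dot (a k) x.
  by rewrite dotDr !dotZr.
have zi : dot (a i) z = b i by rewrite zE; lra.
have zk k : k \in D -> k != i -> dot (a k) z < b k.
  move=> kD ki; have := sy k; rewrite !inE ki kD zE => /(_ isT).
  by have := lt k kD; nra.
exists z => [k kD|].
  by have [->|ki] := eqVneq k i; [rewrite zi | exact/ltW/zk].
apply/setP => k; rewrite !inE; have [->|ki] := eqVneq k i.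
  by rewrite iD zi eqxx.
by have [kD|//] := boolP (k \in D); rewrite lt_eqF // zk.
Qed.

Lemma irr_facet i : i \in D -> facet P (sface a D b [set i]%SET).
Proof.
move=> iD; have [z sz zi] := irr_exact iD.
split; first by apply: face_sface; rewrite finset.sub1set.
rewrite -zi codim_sface // zi.
by have /indep_rank -> := indep_set1 (irr_neq0 iD); rewrite cards1.
Qed.

Lemma normal_cone_sface1 i : i \in D ->
  normal_cone P (sface a D b [set i]%SET) (a i).
Proof.
move=> iD y [sy /=]; rewrite finset.sub1set => /in_tight yi x sx.
by rewrite !(dotC _ (a i)) yi; exact: sx.
Qed.

(** Some constraint is tight on all of [G], since otherwise a relative interior point could move
    along [v]. Its normal and the functional cutting out [G] both lie in the normal cone, a single
    ray, so they cut out the same face. *)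
Lemma facet_irr G v : facet P G -> normal_vector P G v ->
  exists i, [/\ i \in D, G = sface a D b [set i]%SET &
    exists2 t, 0 < t & a i = t *: v].
Proof.
move=> [fG cG] [v0 vE].
have ray u : u != 0 -> normal_cone P G u -> exists2 t, 0 < t & u = t *: v.
  move=> u0; rewrite vE => -[t /= t0 tu]; exists t => //.
  rewrite lt_neqAle t0 andbT eq_sym; apply: contraNneq u0 => t0'.
  by rewrite -tu t0' scale0r.
have vn : normal_cone P G v by rewrite vE; exists 1 => /=; rewrite ?scale1r.
have G0 := codim_nonempty cG.
have GP : G `<=` P by have [? [? [_ ->]]] := fG; move=> x [].
have [z Gz zmin] := min_tight G0 GP (face_midpoint (@sys_midpoint R n I a D b) fG).
have sz := GP z Gz.
have [i iz] : exists i, i \in tight a D b z.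
  apply/finset.set0Pn/negP => /eqP z0.
  have [i|e e0 [se _]] := @move_tight R n I a D b z v sz; first by rewrite z0 inE.
  have := vn z Gz _ se; rewrite !(dotC _ v) dotDr dotZr gerDl leNgt.
  by rewrite mulr_gt0 ?dot_self_gt0.
have iD := fintype.subsetP (tight_sub _ _ _ _) _ iz.
have Gi : G `<=` sface a D b [set i]%SET.
  move=> y Gy; split=> /=; first exact: GP.
  by rewrite finset.sub1set (fintype.subsetP (zmin y Gy)).
have [t t0 ta] : exists2 t, 0 < t & a i = t *: v.
  by apply: ray; [exact: irr_neq0|move=> y /Gi; exact: normal_cone_sface1].
exists i; split => //; last by exists t.
have [c [d [cd GE]]] := fG.
have cn : normal_cone P G c.
  by move=> y; rewrite GE => -[_ /= yd] x sx; rewrite !(dotC _ c) yd cd.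
(* If [c] were 0, [G] would be all of [P], and constraint [i] would be tight at an interior
   point. *)
have c0 : c != 0.
  apply/eqP => c0; have [x sx x0] := interior_point.
  have Gx : G x.
    by move: Gz; rewrite GE => -[_ /=]; rewrite c0 dot0l => <-; split; rewrite //= dot0l.
  by have := fintype.subsetP (zmin x Gx) i iz; rewrite x0 inE.
have [s s0 sc] := ray c c0 cn.
apply/seteqP; split=> // y [sy /=]; rewrite finset.sub1set => /in_tight yi.
rewrite GE; split=> //=; move: (Gz); rewrite {1}GE => -[_ /= <-].
rewrite sc !dotZl; congr (_ * _); apply: (mulfI (lt0r_neq0 t0)).
by rewrite -!dotZl -ta yi (in_tight iz).
Qed.

End IrredundantSystems.

(** Independence comes from counting: by injectivity of the labelling, the facets containing the
    face at [x] are as many as its tight constraints, while simplicity makes their number the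
    codimension, which is the rank of the tight normals. *)
Lemma simple_polyhedron_sys (R : realType) (n : nat) (S : finType)
    (P : set 'rV[R]_n) (F : S -> set 'rV[R]_n) (v : S -> 'rV[R]_n) :
  simple_polyhedron P -> facet_labelling P F ->
  (forall s, normal_vector P (F s) (v s)) ->
  exists h : S -> R, [/\ P = sys v [set: S]%SET h,
    forall s, F s = sface v [set: S]%SET h [set s]%SET &
    indep_tight v [set: S]%SET h].
Proof.
move=> [poly full simple] [Ff Finj Fsurj] vn.
have [m [a [b [D [PE irr]]]]] := polyhedron_irredundant poly.
have full' := full; rewrite PE in full'.
have Fi s : exists i, [/\ i \in D, F s = sface a D b [set i]%SET &
    exists2 t, 0 < t & a i = t *: v s].
  have := vn s; have := Ff s I; rewrite /= PE => fs; exact: facet_irr.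
have iF i : i \in D -> exists s, F s = sface a D b [set i]%SET /\
    exists2 t, 0 < t & a i = t *: v s.
  move=> iD; have /Fsurj[s _ Fs] : facet P (sface a D b [set i]%SET).
    by rewrite PE; exact: irr_facet.
  exists s; split=> //; have [v0 vE] := vn s.
  have := @normal_cone_sface1 _ _ _ a D b i iD; rewrite -Fs -PE vE => -[t /= t0 ta].
  exists t => //; rewrite lt_neqAle t0 andbT eq_sym.
  by apply: contraNneq (irr_neq0 irr full' iD) => t0'; rewrite -ta t0' scale0r.
have Fne s : exists x, F s x.
  by have [_ cF] := Ff s I; exact: codim_nonempty cF.
have [z zF] := choice Fne.
have FP s x : F s x -> P x.
  by have [i [_ -> _]] := Fi s; rewrite PE => -[].
have vmax s y x : F s y -> P x -> dot (v s) x <= dot (v s) y.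
  have vs : normal_cone P (F s) (v s).
    by rewrite (vn s).2; exists 1 => /=; rewrite ?scale1r.
  by move=> Fy Px; rewrite !(dotC (v s)); exact: vs.
pose h s := dot (v s) (z s); exists h.
have PS : P = sys v [set: S]%SET h.
  apply/seteqP; split=> [x Px s _|x sx]; first exact: vmax.
  rewrite PE => i iD; have [s [Fs [t t0 ta]]] := iF i iD.
  have := sx s (finset.in_setT s); rewrite -(ler_pM2l t0) -!dotZl -ta.
  move=> /le_trans; apply; have := zF s; rewrite Fs => -[_ /=].
  by rewrite finset.sub1set => /in_tight ->.
have FS s : F s = sface v [set: S]%SET h [set s]%SET.
  apply/seteqP; split=> x.
    move=> Fx; split=> /=; first by rewrite -PS; exact: FP Fx.
    rewrite finset.sub1set !inE eq_le vmax //=; last exact: FP Fx.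
    by apply: vmax => //; exact: FP (zF s).
  rewrite /sface -PS => -[Px /=]; rewrite finset.sub1set => /in_tight xs.
  have [i [iD Fs [t t0 ta]]] := Fi s; rewrite Fs; split=> /=; first by rewrite -PE.
  have := zF s; rewrite Fs => -[_ /=]; rewrite !finset.sub1set !inE iD => /eqP <-.
  by rewrite ta !dotZl xs /h eqxx.
split=> // x sx; apply/indep_rank.
set A := tight _ _ _ _.
have fA : face P (sface v [set: S]%SET h A) by rewrite PS; exact/face_sface/tight_sub.
have cA : codim (sface v [set: S]%SET h A) (\rank (rows v A)) by apply/codim_sface.
have := simple _ _ fA cA.
suff -> : [set G | facet P G /\ sface v [set: S]%SET h A `<=` G] =
    F @` [set s | s \in A].
  move=> card; apply/card_eq_II; rewrite card_eq_sym.
  apply: card_eq_trans card; rewrite card_eq_sym.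
  apply: card_eq_trans (inj_card_eq _) (card_eq_finset A).
  by move=> s s' _ _; apply: Finj; rewrite inE.
apply/seteqP; split=> [G [/Fsurj[s _ <-]]|_ [s /= sA <-]].
  by rewrite FS sface_sub_exact // finset.sub1set; exists s.
by split; [exact: Ff | rewrite FS sface_sub_exact // finset.sub1set].
Qed.

(** * Nested sets and stellar subdivision *)

Section NestedSets.
Context {T : finType}.
Implicit Types (I J : {set T}) (X Y N : {set {set T}}).

Definition singles J : {set {set T}} := [set [set s]%SET | s in J]%SET.

Lemma singlesP J I :
  reflect (exists2 s, s \in J & I = [set s]%SET) (I \in singles J).
Proof. exact: imsetP. Qed.

Lemma set1_singles J s : ([set s]%SET \in singles J) = (s \in J).
Proof.
by apply/singlesP/idP => [[t tJ /set1_inj ->] // | sJ]; exists s.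
Qed.

Lemma in_cover X x :
  reflect (exists2 I, I \in X & x \in I) (x \in finset.cover X).
Proof. exact: finset.bigcupP. Qed.

Lemma sub_cover X I : I \in X -> I \subset finset.cover X.
Proof. by move=> IX; apply/fintype.subsetP => x xI; apply/in_cover; exists I. Qed.

Lemma coverS X Y : X \subset Y -> finset.cover X \subset finset.cover Y.
Proof.
move=> /fintype.subsetP XY; apply/fintype.subsetP => x /in_cover[I /XY IY xI].
by apply/in_cover; exists I.
Qed.

Lemma cover_sub X J :
  (finset.cover X \subset J) = [forall (I | I \in X), I \subset J].
Proof.
apply/idP/forall_inP => [XJ I /sub_cover/fintype.subset_trans|XJ]; first exact.
by apply/fintype.subsetP => x /in_cover[I /XJ/fintype.subsetP IJ /IJ].
Qed.

Lemma cover_singles J : finset.cover (singles J) = J.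
Proof.
apply/setP => x; apply/in_cover/idP => [[_ /singlesP[s sJ ->]]|xJ].
  by rewrite inE => /eqP ->.
by exists [set x]%SET; rewrite ?set1_singles // inE.
Qed.

Lemma cover_sub_singles X J : X \subset singles J -> finset.cover X \subset J.
Proof. by move=> /coverS; rewrite cover_singles. Qed.

Lemma singles_sub X J : X \subset singles J ->
  singles (finset.cover X) = X.
Proof.
move=> /fintype.subsetP XJ; apply/setP => I; apply/singlesP/idP => [[s]|IX].
  move=> /in_cover[I' I'X sI'] ->; have /singlesP[t _ E] := XJ _ I'X.
  by move: sI'; rewrite {1}E inE => /eqP ->; rewrite -E.
have /singlesP[s _ E] := XJ _ IX; exists s => //.
by apply/in_cover; exists I; rewrite // E inE.
Qed.

Lemma card_singles J : #|singles J| = #|J|.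
Proof. by rewrite card_imset //; exact: set1_inj. Qed.

Lemma antichainS X Y : X \subset Y -> antichain Y -> antichain X.
Proof. by move=> /fintype.subsetP XY aY I J /XY IY /XY; exact: aY. Qed.

Lemma antichain_singles J : antichain (singles J).
Proof.
move=> _ _ /singlesP[s _ ->] /singlesP[t _ ->]; apply: contra.
by rewrite finset.sub1set inE => /eqP ->.
Qed.

Lemma nestedS (K : set {set T}) (B N N' : {set {set T}}) :
  N \subset N' -> nested K B N' -> nested K B N.
Proof.
move=> NN' [N'B nN']; split; first exact: fintype.subset_trans N'B.
by move=> X XN; apply: nN'; exact: fintype.subset_trans NN'.
Qed.

Lemma nested_set1 (K : set {set T}) (B : {set {set T}}) I :
  I \in B -> nested K B [set I]%SET.
Proof.
move=> IB; split; first by rewrite finset.sub1set.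
by move=> X /subset_leq_card le _ X2; have := leq_trans X2 le; rewrite cards1.
Qed.

Lemma nested_set0 (K : set {set T}) (B : {set {set T}}) :
  nested K B finset.set0.
Proof.
split; first exact: finset.sub0set.
by move=> X /subset_leq_card le _ X2; have := leq_trans X2 le; rewrite cards0.
Qed.

Section Stellar.
Variables (K : set {set T}) (B : {set {set T}}) (J : {set T}).
Hypothesis Kdown : forall M N : {set T}, M \subset N -> K N -> K M.
Hypothesis build : building_set K (J |: B)%SET.
Hypothesis singlesB : forall s, [set s]%SET \in B.
Hypothesis large : forall I, I \in B -> #|I| = 1%N \/ (#|J| <= #|I|)%N.
Hypothesis JB : J \in B -> #|J| = 1%N.
Local Notation A := (singles J).

Lemma new_simplex : K J.
Proof. by case: build => /(_ J); rewrite setU11 => /(_ isT)[]. Qed.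

Lemma J_neq0 : J != finset.set0.
Proof. by case: build => /(_ J); rewrite setU11 => /(_ isT)[]. Qed.

Lemma A_sub_B : A \subset B.
Proof. by apply/fintype.subsetP => _ /singlesP[s _ ->]. Qed.

(** The combinatorial effect of the descending order: [large] and [JB] leave nothing but singletons
    of [B] inside [J]. *)
Lemma sub_J_single I : I \in B -> I \subset J -> I \in A.
Proof.
move=> IB IJ; have single : #|I| = 1%N -> I \in A.
  move=> /eqP/cards1P[s sI]; rewrite sI in IJ *.
  by rewrite set1_singles -finset.sub1set.
have [/single //|le] := large IB.
have IJe : I = J by apply/eqP; rewrite eqEcard IJ.
by apply: single; rewrite IJe JB // -IJe.
Qed.

Lemma cover_sub_A X : X \subset A -> (2 <= #|X|)%N -> finset.cover X \notin B.
Proof.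
move=> XA X2; have XJ := cover_sub_singles XA.
apply/negP => /sub_J_single/(_ XJ)/singlesP[s _ E].
by move: X2; rewrite -(singles_sub XA) card_singles E cards1.
Qed.

Lemma nested_singles : nested K B A.
Proof.
split=> [|X XA _ X2]; first exact: A_sub_B.
split; last exact: cover_sub_A.
by exact: Kdown (cover_sub_singles _) new_simplex.
Qed.

(** The degenerate case of the two equivalences below: [J |: B] is [B], and subdividing at a vertex
    changes nothing. *)
Lemma J_single : J \in B -> A = [set J]%SET.
Proof. by move=> /JB/eqP/cards1P[s ->]; rewrite /singles imset_set1. Qed.

Lemma J_large : J \notin B -> (2 <= #|J|)%N.
Proof.
move=> JnB; rewrite ltnNge; apply: contra JnB => J1.
have /cards1P[s ->] : #|J| == 1%N by rewrite eqn_leq J1 card_gt0 J_neq0.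
exact: singlesB.
Qed.

Lemma not_sub_A N : J \notin B -> nested K (J |: B)%SET N -> ~~ (A \subset N).
Proof.
move=> JnB [_ nN]; apply/negP => AN.
have [||_] := nN A AN; first exact: antichain_singles.
  by rewrite card_singles J_large.
by rewrite cover_singles setU11.
Qed.

(** Adding [J] to the building set newly forbids only antichains with union [J]. Their members lie
    inside [J], hence are singletons, so such an antichain is the whole of [A]. *)
Lemma nested_stellar_old N : J \notin N ->
  nested K (J |: B)%SET N <-> nested K B N /\ ~~ (A \subset N).
Proof.
move=> JN; have [JiB|JnB] := boolP (J \in B).
  rewrite (finset.setUidPr _) ?finset.sub1set // J_single // finset.sub1set JN.
  by split=> // -[].
split=> [nN|[[NB nN] AN]].
  split; last exact: not_sub_A nN.
  case: nN => NB nN; split=> [|X XN aX X2].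
    apply/fintype.subsetP => I IN; have := fintype.subsetP NB I IN.
    by rewrite in_setU1; case: eqP IN JN => // -> ->.
  by have [KX] := nN X XN aX X2; rewrite in_setU1 negb_or => /andP[].
split=> [|X XN aX X2]; first exact: fintype.subset_trans (finset.subsetUr _ _).
have [KX XB] := nN X XN aX X2; split=> //.
rewrite in_setU1 negb_or XB andbT; apply: contra AN => /eqP XJ.
have XA : X \subset A.
  apply/fintype.subsetP => I IX; apply: sub_J_single.
    exact: (fintype.subsetP NB _ (fintype.subsetP XN _ IX)).
  by rewrite -XJ sub_cover.
by rewrite -XJ (singles_sub XA).
Qed.

(** In either direction a critical antichain [X] on one side is turned into an antichain [Y] on the
    other, with the same union or with [J] added to it, and nestedness is applied to [Y]. *)
Lemma nested_stellar_new N : J \notin N ->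
  nested K (J |: B)%SET (J |: N)%SET <->
  nested K B (N :|: A)%SET /\ ~~ (A \subset N).
Proof.
move=> JN; have [JiB|JnB] := boolP (J \in B).
  rewrite (finset.setUidPr _) ?finset.sub1set // J_single // finset.sub1set JN.
  by rewrite finset.setUC; split=> // -[].
have J2 := J_large JnB.
split=> [nM|[nNA AN]].
- have nN : nested K (J |: B)%SET N by apply: nestedS nM; exact: finset.subsetUr.
  have [[NB _] AN] := (nested_stellar_old JN).1 nN.
  split=> //; split=> [|X XNA aX X2]; first by rewrite finset.subUset NB A_sub_B.
  have [XN|/subsetPn[a aX' aN]] := boolP (X \subset N).
    by have [KX] := nN.2 X XN aX X2; rewrite in_setU1 negb_or => /andP[].
  have /singlesP[s sJ aE] : a \in A.
    by have := fintype.subsetP XNA a aX'; rewrite inE (negbTE aN).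
  have noJ I : I \in X -> ~~ (J \subset I).
    move=> IX; apply/negP => JI; have [aI|aI] := eqVneq a I.
      by have := subset_leq_card JI; rewrite -aI aE cards1 leqNgt J2.
    by have := aX a I aX' IX aI; rewrite aE finset.sub1set (fintype.subsetP JI).
  (* [J] absorbs the members of [X] inside it, so that [Y] is nested with [J]. *)
  pose Y := (J |: [set I in X | ~~ (I \subset J)])%SET.
  have YE : finset.cover Y = (finset.cover X :|: J)%SET.
    apply/eqP; rewrite finset.eqEsubset finset.subUset.
    rewrite (sub_cover (setU11 _ _)) andbT.
    rewrite cover_sub; apply/andP; split.
      apply/forall_inP => I; rewrite in_setU1 inE => /orP[/eqP ->|/andP[IX _]].
        exact: finset.subsetUr.
      by apply: fintype.subset_trans (finset.subsetUl _ _); exact: sub_cover.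
    rewrite cover_sub; apply/forall_inP => I IX; have [IJ|IJ] := boolP (I \subset J).
      exact: fintype.subset_trans IJ (sub_cover (setU11 _ _)).
    by apply: sub_cover; rewrite in_setU1 inE IX IJ orbT.
  have [XJ|XJ] := boolP (X \subset A).
    by split; [exact: Kdown (cover_sub_singles _) new_simplex
              |exact: cover_sub_A].
  have {XJ}[I IX IJ] : exists2 I, I \in X & ~~ (I \subset J).
    have /subsetPn[I IX IA] := XJ; exists I => //; apply: contra IA => IJ.
    have := fintype.subsetP XNA I IX; rewrite inE => /orP[IN|//].
    exact: sub_J_single (fintype.subsetP NB _ IN) IJ.
  have YM : Y \subset (J |: N)%SET.
    apply/fintype.subsetP => I'; rewrite !in_setU1 inE => /orP[->//|/andP[I'X I'J]].
    have := fintype.subsetP XNA I' I'X; rewrite inE => /orP[->|/singlesP[t tJ E]].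
      by rewrite orbT.
    by move: I'J; rewrite E finset.sub1set tJ.
  have aY : antichain Y.
    move=> I1 I2; rewrite !in_setU1 !inE.
    move=> /orP[/eqP ->|/andP[I1X I1J]] /orP[/eqP ->|/andP[I2X I2J]] //.
    - by rewrite eqxx.
    - by move=> _; exact: noJ.
    - exact: aX.
  have [|KY] := nM.2 Y YM aY.
    apply/card_gt1P; exists J, I; rewrite setU11 in_setU1 inE IX IJ orbT; split=> //.
    by apply: contraNneq IJ => ->.
  rewrite YE => YB; rewrite YE in KY.
  split; first by apply: Kdown KY; exact: finset.subsetUl.
  (* [cover X] meets [J] in [s]; were it in [B], closure under unions would put [cover Y] into the
     building set. *)
  apply: contra YB => XB; case: build => _ _; apply; rewrite ?setU11 //.
    by rewrite in_setU1 XB orbT.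
  apply/finset.set0Pn; exists s; rewrite inE sJ andbT.
  by apply/in_cover; exists a; rewrite // aE inE.
- have nN : nested K B N by apply: nestedS nNA; exact: finset.subsetUl.
  split=> [|X XM aX X2].
    by apply: finset.setUS; case: nN.
  have [JX|JX] := boolP (J \in X); last first.
    have XN : X \subset N.
      apply/fintype.subsetP => I IX; have := fintype.subsetP XM I IX.
      by rewrite in_setU1; case: eqP IX JX => // -> ->.
    by apply: ((nested_stellar_old JN).2 (conj nN AN)).2.
  have IJ I : I \in (X :\ J)%SET -> ~~ (I \subset J) /\ ~~ (J \subset I).
    by rewrite !inE => /andP[IJ IX]; split; apply: aX; rewrite // eq_sym.
  have [I IX] : exists I, I \in (X :\ J)%SET.
    by apply/finset.set0Pn; rewrite -card_gt0; move: X2; rewrite (cardsD1 J X) JX.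
  (* [J] is traded for those of its singletons not covered by [X :\ J]. *)
  pose Y := ((X :\ J) :|: [set a in A | ~~ (a \subset finset.cover (X :\ J))])%SET.
  have inY I' : I' \in Y = (I' \in (X :\ J)%SET) ||
      (I' \in A) && ~~ (I' \subset finset.cover (X :\ J)%SET).
    by rewrite finset.in_setU [X in _ || X]inE.
  have YE : finset.cover Y = finset.cover X.
    apply/eqP; rewrite finset.eqEsubset !cover_sub; apply/andP; split.
      apply/forall_inP => I'; rewrite inY => /orP[|/andP[/singlesP[s sJ ->] _]].
        by rewrite inE => /andP[_]; exact: sub_cover.
      by rewrite finset.sub1set; apply/in_cover; exists J.
    apply/forall_inP => I' I'X; have [->|I'J] := eqVneq I' J; last first.
      by apply: sub_cover; rewrite inY !inE I'J I'X.
    apply/fintype.subsetP => s sJ; apply/in_cover.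
    have [/in_cover[I2 I2X sI2]|sX] := boolP (s \in finset.cover (X :\ J)%SET).
      by exists I2; rewrite // inY I2X.
    exists [set s]%SET; last by rewrite inE.
    by rewrite inY set1_singles sJ finset.sub1set sX orbT.
  have aY : antichain Y.
    move=> I1 I2; rewrite !inY.
    move=> /orP[I1X|/andP[/singlesP[s1 s1J E1] I1X]]
           /orP[I2X|/andP[/singlesP[s2 s2J E2] I2X]].
    - by apply: aX; [move: I1X|move: I2X]; rewrite inE => /andP[].
    - move=> _; apply: contra (IJ _ I1X).1 => /fintype.subset_trans; apply.
      by rewrite E2 finset.sub1set.
    - move=> _; apply: contra I1X => /fintype.subset_trans; apply; exact: sub_cover.
    - by apply: (@antichain_singles J); rewrite ?E1 ?E2 set1_singles.
  have YN : Y \subset (N :|: A)%SET.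
    apply/fintype.subsetP => I'; rewrite inY => /orP[|/andP[I'A _]].
      rewrite inE => /andP[I'J /(fintype.subsetP XM)].
      by rewrite in_setU1 inE; move: I'J; rewrite inE => /negbTE -> /= ->.
    by rewrite inE I'A orbT.
  have IY : I \in Y by rewrite inY IX.
  have Y2 : (2 <= #|Y|)%N.
    (* A member of [Y] containing an element [s] of [J] outside [I] differs from [I]. *)
    have /subsetPn[s sJ sI] := (IJ I IX).2; apply/card_gt1P.
    have [/in_cover[I2 I2X sI2]|sX] := boolP (s \in finset.cover (X :\ J)%SET).
      exists I, I2; rewrite !inY I2X IX; split=> //.
      by apply: contraNneq sI => ->.
    exists I, [set s]%SET; split=> //.
      by rewrite inY set1_singles sJ finset.sub1set sX orbT.
    by apply: contraNneq (IJ I IX).1 => ->; rewrite finset.sub1set.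
  have [KY YB] := nNA.2 Y YN aY Y2; rewrite YE in KY YB; split=> //.
  rewrite in_setU1 negb_or YB andbT; apply: contraNneq (IJ I IX).1 => <-.
  by apply: sub_cover; move: IX; rewrite inE => /andP[].
Qed.

End Stellar.

Lemma nested_all_singles (K : set {set T}) N :
  (forall M N : {set T}, M \subset N -> K N -> K M) ->
  (forall s, K [set s]%SET) -> K finset.set0 ->
  nested K (singles [set: T]%SET) N <->
  N \subset singles [set: T]%SET /\ K (finset.cover N).
Proof.
move=> Kdown K1 K0; split=> [[NS nN]|[NS KN]].
  split=> //; have [N2|N1] := ltnP 1 #|N|.
    by have [] := nN N (fintype.subxx _) (antichainS NS (@antichain_singles _)) N2.
  have [N0|] := posnP #|N|; first by rewrite (cards0_eq N0) /finset.cover big_set0.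
  move=> N0; have /cards1P[I NI] : #|N| == 1%N by rewrite eqn_leq N1 N0.
  move: NS; rewrite NI finset.sub1set => /singlesP[s _ ->].
  by rewrite /finset.cover big_set1.
split=> // X XN _ X2; split; first exact: Kdown (coverS XN) KN.
apply/negP => /singlesP[s _ E].
by move: X2; rewrite -(singles_sub (fintype.subset_trans XN NS)) card_singles E cards1.
Qed.

End NestedSets.

(** * Repeated truncation *)

Section TruncationStages.
Context {R : realType} {n : nat} {S : finType}.
Variables (P : set 'rV[R]_n) (F : S -> set 'rV[R]_n) (v : S -> 'rV[R]_n).
Variables (B : {set {set S}}) (Is : seq {set S}) (h0 : S -> R).
Hypothesis PE : P = sys v [set: S]%SET h0.
Hypothesis FE : forall s, F s = sface v [set: S]%SET h0 [set s]%SET.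
Hypothesis ind0 : indep_tight v [set: S]%SET h0.
Hypothesis P0 : P !=set0.
Local Notation K := (dual_complex P F).
Local Notation W := (sum_vec v).
Hypothesis build : building_set K B.
Hypothesis listIs : descending_listing B Is.

(** Singletons belong to every stage, listed or not, because they index the facets of [P]; so the
    first nested complex is the dual complex of [P]. *)
Definition stage (Js : seq {set S}) : {set {set S}} :=
  (singles [set: S] :|: [set I in Js])%SET.

Lemma sum_vec1 s : W [set s]%SET = v s.
Proof. exact: big_set1. Qed.

Lemma in_facet s x : F s x <-> P x /\ dot (v s) x = h0 s.
Proof.
rewrite FE PE; split=> [[sx /=]|[sx xs]]; rewrite ?finset.sub1set.
  by move=> /in_tight.
by split=> //=; rewrite finset.sub1set !inE xs eqxx.
Qed.

Lemma dual_complexS (M N : {set S}) : M \subset N -> K N -> K M.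
Proof.
move=> /fintype.subsetP MN [x [Px xN]]; exists x; split=> //= s /MN; exact: xN.
Qed.

Lemma dual_complex0 : K finset.set0.
Proof. by have [x Px] := P0; exists x; split=> //= s; rewrite inE. Qed.

Lemma singles_B s : [set s]%SET \in B.
Proof. by case: build. Qed.

Lemma dual_complex1 s : K [set s]%SET.
Proof. by case: build => /(_ _ (singles_B s))[]. Qed.

Lemma mem_stage Js I :
  (I \in stage Js) = (I \in singles [set: S]%SET) || (I \in Js).
Proof. by rewrite [LHS]inE [X in _ || X]inE. Qed.

Lemma stage_single Js s : [set s]%SET \in stage Js.
Proof. by rewrite mem_stage set1_singles inE. Qed.

Lemma stage_rcons Js J : stage (rcons Js J) = (J |: stage Js)%SET.
Proof.
by apply/setP => I; rewrite in_setU1 !mem_stage mem_rcons inE orbCA.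
Qed.

Lemma stage_all : stage Is = B.
Proof.
case: listIs => _ IsB _; apply/setP => I; rewrite mem_stage IsB.
have [/singlesP[s _ ->]|//] := boolP (I \in singles _); by rewrite singles_B.
Qed.

Lemma descending Js Js' I J : Is = Js ++ Js' -> I \in Js -> J \in Js' ->
  (#|J| <= #|I|)%N.
Proof.
case: listIs => _ _.
rewrite sorted_pairwise => [+ IsE|I1 I2 I3 /= le1 le2]; last first.
  exact: leq_trans le2 le1.
by rewrite IsE pairwise_cat => /and3P[/allrelP le _ _]; exact: le.
Qed.

Lemma stage_cases Js I : I \in stage Js -> #|I| = 1%N \/ I \in Js.
Proof.
by rewrite mem_stage => /orP[/singlesP[s _ ->]|]; [left; rewrite cards1|right].
Qed.

Lemma stage_sub Js Js' : Is = Js ++ Js' -> stage Js \subset B.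
Proof.
move=> IsE; rewrite -stage_all; apply/fintype.subsetP => I; rewrite !mem_stage.
by rewrite IsE mem_cat => /orP[->//|->]; rewrite orbT.
Qed.

(* A union of two incomparable listed sets is larger than both, so it was listed
   before them: this is where the descending order is needed. *)
Lemma building_stage Js Js' : Is = Js ++ Js' -> building_set K (stage Js).
Proof.
move=> IsE; have sB := fintype.subsetP (stage_sub IsE).
case: build => BK _ BU; split=> [I /sB/BK //|s|I J IS JS IJ KIJ].
  exact: stage_single.
have [/finset.setUidPr ->//|IJ'] := boolP (I \subset J).
have [/finset.setUidPl ->//|JI'] := boolP (J \subset I).
have nonsingle (I1 I2 : {set S}) : (I1 :&: I2)%SET != finset.set0 ->
    ~~ (I1 \subset I2) -> #|I1| != 1%N.
  move=> /finset.set0Pn[s]; rewrite inE => /andP[s1 s2].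
  apply: contra => /cards1P[t E]; move: s1; rewrite E inE => /eqP <-.
  by rewrite finset.sub1set.
have [/eqP|IJs] := stage_cases IS.
  by rewrite (negbTE (nonsingle _ _ IJ IJ')).
have UB : (I :|: J)%SET \in B by apply: BU => //; exact: sB.
case: (listIs) => _ IsB _; move: UB; rewrite -IsB IsE mem_cat => /orP[UJs|UJs'].
  by rewrite mem_stage UJs orbT.
have := descending IsE IJs UJs'; rewrite leqNgt proper_card //.
by rewrite properE finset.subsetUl finset.subUset fintype.subxx.
Qed.

Definition stage_ok Js (h : {set S} -> R) :=
  [/\ indep_tight W (stage Js) h,
      forall N, pcomplex W (stage Js) h N <-> nested K (stage Js) N,
      sys W (stage Js) h `<=` P &
      forall s, [set s]%SET \notin Js -> h [set s]%SET = h0 s].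

Lemma stage_ok_nil : exists2 h, stage_ok [::] h & P = sys W (stage [::]) h.
Proof.
pose h (I : {set S}) := \sum_(s in I) h0 s.
have h1 s : h [set s]%SET = h0 s by exact: big_set1.
have stE : stage [::] = singles [set: S]%SET.
  by apply/setP => I; rewrite mem_stage orbF.
have PW : P = sys W (stage [::]) h.
  rewrite PE stE; apply/seteqP; split=> x sx.
    by move=> _ /singlesP[s _ ->]; rewrite sum_vec1 h1; exact: sx.
  by move=> s _; rewrite -sum_vec1 -h1; apply: sx; rewrite set1_singles inE.
exists h => //; split=> //; last by rewrite -PW.
- move=> x; rewrite -PW PE => /ind0; set t := tight _ _ _ _ => indt.
  have -> : tight W (stage [::]) h x = singles t.
    apply/setP => I; rewrite stE inE.
    apply/andP/singlesP => [[/singlesP[s _ ->] xs]|[s st ->]].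
      by exists s => //; rewrite !inE -sum_vec1 -h1.
    by rewrite set1_singles inE sum_vec1 h1 (in_tight st).
  move=> c; rewrite big_imset /=; last by move=> s1 s2 _ _; exact: set1_inj.
  under eq_bigr do rewrite sum_vec1.
  by move=> /(indt (fun s => c [set s]%SET)) c0 _ /singlesP[s st ->]; exact: c0.
- move=> N; rewrite {2}stE nested_all_singles; first last.
  + exact: dual_complex0.
  + exact: dual_complex1.
  + exact: dual_complexS.
  split=> [[x [sx /= xN]]|[NS [x [Px /= xN]]]].
    split; first by rewrite -stE; exact: fintype.subset_trans xN (tight_sub _ _ _ _).
    exists x; rewrite -PW in sx; split=> //= s /in_cover[I IN sI].
    have Ix := fintype.subsetP xN I IN; move: (Ix).
    rewrite inE stE => /andP[/singlesP[s' _ E] _].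
    move: sI; rewrite E inE => /eqP ->; apply/in_facet; split=> //.
    by rewrite -sum_vec1 -h1 -E; exact: in_tight Ix.
  exists x; split=> /=; first by rewrite -PW.
  apply/fintype.subsetP => I IN; rewrite inE stE (fintype.subsetP NS) //=.
  have /singlesP[s _ E] := fintype.subsetP NS I IN.
  have /in_facet[_ xs] : F s x by apply: xN; apply/in_cover; exists I; rewrite // E inE.
  by rewrite E sum_vec1 h1 xs.
Qed.

Section OneStep.
Variables (Js Js' : seq {set S}) (J : {set S}) (h : {set S} -> R).
Hypotheses (IsE : Is = Js ++ J :: Js') (ok : stage_ok Js h).
Local Notation D := (stage Js).
Local Notation A := (singles J).

Lemma J_notin : J \notin Js.
Proof.
case: listIs => + _ _; rewrite IsE cat_uniq => /and3P[_ /hasPn disj _].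
by apply: disj; rewrite mem_head.
Qed.

Lemma IsE_rcons : Is = rcons Js J ++ Js'.
Proof. by rewrite cat_rcons. Qed.

Lemma J_old : J \in D -> #|J| = 1%N.
Proof. by case/stage_cases => //; rewrite (negbTE J_notin). Qed.

Lemma stage_large I : I \in D -> #|I| = 1%N \/ (#|J| <= #|I|)%N.
Proof.
case/stage_cases => [|IJs]; [by left|right].
by apply: descending IsE IJs _; rewrite mem_head.
Qed.

Lemma build_step : building_set K (J |: D)%SET.
Proof. by rewrite -stage_rcons; exact: building_stage IsE_rcons. Qed.

(** By the order, a singleton listed before [J] leaves [J] at most one element; if it lay inside [J]
    it would equal [J], which is listed only once. *)
Lemma untouched s : s \in J -> [set s]%SET \notin Js.
Proof.
move=> sJ; apply/negP => sJs.
have := descending IsE sJs (mem_head _ _); rewrite cards1 => J1.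
have JE : J = [set s]%SET.
  by apply/eqP; rewrite eq_sym eqEcard finset.sub1set sJ cards1.
by have := J_notin; rewrite JE sJs.
Qed.

Lemma facet_meet_stage :
  facet_meet P F J `&` sys W D h = sface W D h A.
Proof.
case: ok => _ _ DP hs; apply/seteqP; split=> x.
  move=> [[Px /= xJ] sx]; split=> //=; apply/sub_tight.
    exact: A_sub_B (stage_single Js).
  move=> _ /singlesP[s sJ ->]; rewrite sum_vec1 hs ?untouched //.
  by have /in_facet[] := xJ s sJ.
move=> [sx /= xA]; split=> //; split; first exact: DP.
move=> s sJ; apply/in_facet; split; first exact: DP.
rewrite -sum_vec1 -hs ?untouched //; apply: in_tight; apply: (fintype.subsetP xA).
by rewrite set1_singles.
Qed.

Lemma W_singles : W J = \sum_(I in A) W I.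
Proof.
rewrite big_imset /=; last by move=> s1 s2 _ _; exact: set1_inj.
by apply: eq_bigr => s _; rewrite sum_vec1.
Qed.

Lemma pcomplex_A : pcomplex W D h A.
Proof.
case: ok => _ -> _ _.
exact: nested_singles dual_complexS build_step (stage_single Js) stage_large J_old.
Qed.

Lemma step_exists :
  exists b, truncates (sys W D h) (facet_meet P F J `&` sys W D h) (W J) b.
Proof.
rewrite facet_meet_stage; case: ok => indD _ _ _.
apply: truncates_exists W_singles => //; exact: pcomplex_sub pcomplex_A.
Qed.

Lemma step_ok b :
  truncates (sys W D h) (facet_meet P F J `&` sys W D h) (W J) b ->
  let h' I := if I == J then b else h I in
  stage_ok (rcons Js J) h' /\
  truncation (sys W D h) (W J) b = sys W (stage (rcons Js J)) h'.
Proof.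
rewrite facet_meet_stage => tr h'; rewrite /stage_ok stage_rcons.
case: ok => indD pD DP hs.
have tE := truncation_sys pcomplex_A tr.
split=> //; split.
- exact: indep_tight_truncation indD pcomplex_A W_singles _ tr.
- move=> N; have [JN|JN] := boolP (J \in N).
    rewrite -(finset.setD1K JN).
    have JN' : J \notin (N :\ J)%SET by rewrite !inE eqxx.
    rewrite (pcomplex_truncation_new indD pcomplex_A tr JN').
    rewrite (nested_stellar_new dual_complexS build_step (stage_single Js)
      stage_large J_old JN').
    by rewrite pD.
  rewrite (pcomplex_truncation_old indD pcomplex_A tr JN).
  rewrite (nested_stellar_old build_step (stage_single Js) stage_large J_old JN).
  by rewrite pD.
- by rewrite -tE => x [/DP].
- move=> s; rewrite mem_rcons inE negb_or => /andP[sJ sJs].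
  by rewrite /h' (negbTE sJ) hs.
Qed.

End OneStep.

(** [step_ok] asks nothing of [b] beyond [truncates], so the invariant passes along every run;
    [step_exists] keeps a run from getting stuck. *)
Lemma stages Js Js' h : Is = Js ++ Js' -> stage_ok Js h ->
  (exists Q, repeated_truncation P F v (sys W (stage Js) h) Js' Q) /\
  (forall Q, repeated_truncation P F v (sys W (stage Js) h) Js' Q ->
     exists2 h', stage_ok Is h' & Q = sys W B h').
Proof.
elim: Js' Js h => [|J Js' IH] Js h IsE ok /=.
  split; first by eexists.
  by move=> Q ->; exists h; rewrite ?stage_all // -?stage_all IsE cats0.
split.
  have [b tr] := step_exists IsE ok; have [ok' tE] := step_ok IsE ok tr.
  have [[Q rQ] _] := IH _ _ (IsE_rcons IsE) ok'.
  by exists Q, b; rewrite tE.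
move=> Q [b [tr]]; have [ok' ->] := step_ok IsE ok tr.
by have [_] := IH _ _ (IsE_rcons IsE) ok'; apply.
Qed.

Lemma stage_ok_nestohedron h : stage_ok Is h ->
  nestohedron K B (sys W B h) /\ normal_fan (sys W B h) = nested_fan v K B.
Proof.
rewrite /stage_ok stage_all => -[indB pB _ _].
have ne : sys W B h !=set0 by apply/(pcomplex0 W); rewrite pB; exact: nested_set0.
have irr I : I \in B -> pcomplex W B h [set I]%SET.
  by move=> IB; rewrite pB; exact: nested_set1.
have pE : pcomplex W B h = nested K B by apply/seteqP; split=> N; rewrite pB.
split; last by rewrite normal_fan_sys // pE.
split; first exact: sys_simple.
exists {I | I \in B}, (fun t => sface W B h [set val t]%SET).
by split; [exact: facet_labelling_sys | rewrite -pE; exact: complex_iso_sys].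
Qed.

End TruncationStages.

Theorem proposition3p6p2 (R : realType) (n : nat) (S : finType)
    (P : set 'rV[R]_n) (F : S -> set 'rV[R]_n) (v : S -> 'rV[R]_n)
    (B : {set {set S}})
    (simpleP : simple_polyhedron P)
    (labelF : facet_labelling P F)
    (normalV : forall s, normal_vector P (F s) (v s))
    (buildB : building_set (dual_complex P F) B)
    (Is : seq {set S})
    (listIs : descending_listing B Is) :
  (exists Q : set 'rV[R]_n, repeated_truncation P F v P Is Q) /\
  (forall Q : set 'rV[R]_n, repeated_truncation P F v P Is Q ->
     nestohedron (dual_complex P F) B Q /\
     normal_fan Q = nested_fan v (dual_complex P F) B).
Proof.
have [h0 [PE FE ind0]] := simple_polyhedron_sys simpleP labelF normalV.
have P0 : P !=set0 by case: simpleP => _ /codim_nonempty.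
have [h ok PW] := stage_ok_nil PE FE ind0 P0 buildB.
have [ex all] := stages PE FE buildB listIs (erefl : Is = [::] ++ Is) ok.
rewrite -PW in ex all; split=> // Q /all[h' ok' ->].
exact: stage_ok_nestohedron ok'.
Qed.
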